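(* Let $(\mathcal X,\rho)$ be a non-empty Polish metric space with Borel $\sigma$-field $\mathfrak B(\mathcal X)$, and let $\mathcal Y\in\mathfrak B(\mathcal X)$ satisfy $$c_{x,0}\,s^{-\gamma}\le \log \mathcal N_{\mathcal X}(s,\mathcal Y,\rho)\le c_{x,1}\,s^{-\gamma}\qquad\text{for all } s\in(0,s_0),$$ for constants $s_0>0$, $0<c_{x,0}<c_{x,1}$, $\gamma>0$. Fix $C>0$, $\beta\in(0,1]$, $\kappa>0$. Let $\mathcal P_{C,\beta,\kappa}$ be the set of pairs $(P_X,P_Y)$ of probability measures on $\mathfrak B(\mathcal X)$ with $P_X(\mathcal Y)=P_Y(\mathcal Y)=1$, $\operatorname{TV}(P_X,P_Y)\ge\kappa$, and such that there is a Borel set $\mathcal Y_0\subseteq\mathcal Y$ with $(P_X+P_Y)(\mathcal Y_0)=2$ and $|p_X(y)-p_X(z)|\le C\rho(y,z)^\beta$ for all $y,z\in\mathcal Y_0$, where $p_X=\mathrm dP_X/\mathrm d(P_X+P_Y)$. Supervised classification model: the training sample $(Z_1,W_1),\dots,(Z_n,W_n)$ is i.i.d., with $W_j\in\{0,1\}$, $P[W_1=1]=w$ for a fixed $w\in(0,1)$, and conditionally on $W_j=0$ (resp. $W_j=1$) $Z_j$ has law $P_X$ (resp. $P_Y$); a further observation $Z$, independent of the training sample, has law $P_X$ or $P_Y$. Define, with $K=1_{[0,1)}$ and $h=\{d\log n\}^{-1/\gamma}$, where $d\in(0,\eta\,c_{x,1}^{-1}4^{-\gamma})$ for some $\eta\in(0,1/2)$,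 $$\hat p_X(z)=\frac{\sum_{j=1}^n(1-W_j)K(\rho(z,Z_j)/h)}{\sum_{j=1}^n(1-W_j)},\qquad \hat p_Y(z)=\frac{\sum_{j=1}^nW_jK(\rho(z,Z_j)/h)}{\sum_{j=1}^nW_j}$$ when $\sum_j(1-W_j)\in(0,n)$, and otherwise $\hat p_X(z)=0$ or $\hat p_Y(z)=0$ respectively by convention (for the group with empty denominator); and let $\varphi=0$ if $\hat p_X(Z)\ge\hat p_Y(Z)$, $\varphi=1$ otherwise. The excess risk is $$\mathcal E_n(\varphi)=\sup_{(P_X,P_Y)\in\mathcal P_{C,\beta,\kappa}}\big(P_{X,Y,X}[\varphi=1]+P_{X,Y,Y}[\varphi=0]-1+\operatorname{TV}(P_X,P_Y)\big),$$ where $P_{X,Y,X}$ and $P_{X,Y,Y}$ denote the probability when $Z$ has law $P_X$, respectively $P_Y$. Then $$\mathcal E_n(\varphi)=\mathcal O\big((\log n)^{-\beta/\gamma}\big)\quad(n\to\infty).$$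
   Context: $\mathcal N_{\mathcal X}(\delta,\mathcal Y,\rho)$ denotes the minimal number of open $\rho$-balls in $\mathcal X$ of radius $\delta$ whose union contains $\mathcal Y$. $\operatorname{TV}(P,Q)=\sup_{A\in\mathfrak B(\mathcal X)}|P(A)-Q(A)|$. *)

(* Defs.v *)
From HB Require Import structures.
From mathcomp Require Import all_boot all_order all_algebra.
From mathcomp Require Import all_classical all_reals all_analysis.
Set Implicit Arguments. Unset Strict Implicit. Unset Printing Implicit Defensive.
Import Order.TTheory GRing.Theory Num.Theory.
Local Open Scope classical_set_scope.
Local Open Scope ring_scope.

Section Defs.
Context {R : realType}.

Section Metric.
Context {T : Type} (rho : T -> T -> R).

Definition is_metric : Prop :=
  (forall x y, 0 <= rho x y) /\ (forall x y, rho x y = 0 <-> x = y) /\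
  (forall x y, rho x y = rho y x) /\
  (forall x y z, rho x z <= rho x y + rho y z).

Definition rball (x : T) (e : R) : set T := [set y | rho x y < e].

Definition rho_open (A : set T) : Prop :=
  forall x, A x -> exists2 e : R, 0 < e & rball x e `<=` A.

Definition rho_separable : Prop :=
  exists D : set T, countable D /\
    forall x (e : R), 0 < e -> exists2 y, D y & rho x y < e.

Definition rho_complete : Prop :=
  forall u : nat -> T,
    (forall e : R, 0 < e -> exists N, forall m k, (N <= m)%N -> (N <= k)%N ->
        rho (u m) (u k) < e) ->
    exists x, forall e : R, 0 < e -> exists N, forall m, (N <= m)%N -> rho (u m) x < e.

Definition polish_metric : Prop := [/\ is_metric, rho_separable & rho_complete].

(* N_X(delta, Y, rho): minimal number of open rho-balls in X (centres anywhere
   in X) of radius delta whose union contains Y; +oo if no finite cover. *)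
Definition covering_number (delta : R) (Y : set T) : \bar R :=
  ereal_inf [set (k%:R)%:E | k in
    [set k : nat | exists c : 'I_k -> T,
       Y `<=` \bigcup_(i in [set: 'I_k]) rball (c i) delta]].
End Metric.

Definition TV {d} {T : measurableType d} (P Q : probability T R) : \bar R :=
  ereal_sup [set `|P A - Q A|%E | A in [set A | measurable A]].

Definition in_class {d} {T : measurableType d} (rho : T -> T -> R) (Y : set T)
    (C beta kappa : R) (PX PY : probability T R) : Prop :=
  [/\ PX Y = 1%E, PY Y = 1%E, (kappa%:E <= TV PX PY)%E &
    exists Y0 : set T, exists p : T -> R,
      [/\ measurable Y0 /\ Y0 `<=` Y,
          measure_add PX PY Y0 = 2%:E,
          measurable_fun setT p,
          (forall A, measurable A ->
             PX A = (\int[measure_add PX PY]_(x in A) (p x)%:E)%E) &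
          (forall y z, Y0 y -> Y0 z -> `|p y - p z| <= C * rho y z `^ beta)]].

(* Training pairs (Zs j, Ws j), j < n, and the new observation Z, realised on
   a probability space Omega.  The index None stands for the observation Z
   (paired with the constant label false, which is irrelevant). *)
Definition obs_family {dO} {Omega : measurableType dO} {T : Type} (n : nat)
  (Zs : 'I_n -> Omega -> T) (Ws : 'I_n -> Omega -> bool) (Z : Omega -> T) :
  option 'I_n -> Omega -> T * bool :=
  fun i => match i with Some j => fun o => (Zs j o, Ws j o)
                      | None => fun o => (Z o, false) end.

Definition mutually_independent {dO dT} {Omega : measurableType dO}
  {V : measurableType dT} {I : finType} (P : probability Omega R)
  (X : I -> Omega -> V) : Prop :=
  forall A : I -> set V, (forall i, measurable (A i)) ->
    P (\bigcap_(i in [set: I]) (X i @^-1` A i)) =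
    (\prod_(i : I) P (X i @^-1` A i))%E.

Definition classification_model {dO d} {Omega : measurableType dO}
  {T : measurableType d} (P : probability Omega R) (n : nat) (w : R)
  (PX PY : probability T R)
  (Zs : 'I_n -> Omega -> T) (Ws : 'I_n -> Omega -> bool) (Z : Omega -> T)
  (PZ : probability T R) : Prop :=
  [/\ (forall j, measurable_fun setT (Zs j)) /\
      (forall j, measurable_fun setT (Ws j)),
      measurable_fun setT Z,
      mutually_independent P (obs_family Zs Ws Z),
      (forall j A, measurable A ->
         P ([set o | Zs j o \in A] `&` [set o | Ws j o = false]) = ((1 - w)%:E * PX A)%E
      /\ P ([set o | Zs j o \in A] `&` [set o | Ws j o = true]) = (w%:E * PY A)%E) &
      (forall A, measurable A -> P (Z @^-1` A) = PZ A)].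

Definition Kind (u : R) : R := if (0 <= u) && (u < 1) then 1 else 0.

Definition bandwidth (d gamma : R) (n : nat) : R :=
  (d * ln n%:R) `^ (- gamma^-1).

Section Classifier.
Context {T : Type} (rho : T -> T -> R) (n : nat) (h : R)
  (zs : 'I_n -> T) (ws : 'I_n -> bool).

Definition n0 : nat := #|[set j : 'I_n | ~~ ws j]|.
Definition n1 : nat := #|[set j : 'I_n | ws j]|.

Definition pX_hat (z : T) : R :=
  if (n0 == 0)%N then 0
  else (\sum_(j < n) (1 - (ws j)%:R) * Kind (rho z (zs j) / h)) / n0%:R.

Definition pY_hat (z : T) : R :=
  if (n1 == 0)%N then 0
  else (\sum_(j < n) (ws j)%:R * Kind (rho z (zs j) / h)) / n1%:R.

Definition phi (z : T) : bool := pX_hat z < pY_hat z.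
End Classifier.

End Defs.

(* Main.v *)
Require Import Defs.
From HB Require Import structures.
From mathcomp Require Import all_boot all_order all_algebra.
From mathcomp Require Import all_classical all_reals all_analysis.
From mathcomp Require Import measurable_realfun ring lra.
Set Implicit Arguments. Unset Strict Implicit. Unset Printing Implicit Defensive.
Import Order.TTheory GRing.Theory Num.Theory.
Local Open Scope classical_set_scope.
Local Open Scope ring_scope.

(** Write p for the density of P_X with respect to P_X + P_Y and F for the set of
    pairs (z, t), with t a training sample, on which the classifier answers 1.
    Pointwise in t, the excess risk of the section F_t is the (P_X + P_Y)-integral
    of |2p - 1| over the set where F_t disagrees with p < 1/2.  The points with
    |2p - 1| <= 4 C h^beta contribute O(h^beta).  At any other point z, the Hölder
    condition makes the difference between P_X and P_Y of the ball B(z, h) at least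
    2 C h^beta m, with m = (P_X + P_Y)(B(z, h)), and Chebyshev's inequality for
    the four counts that enter the classifier bounds the probability of an error
    at z by K / m, where K is of order 1 / (n h^(2 beta)).  If z lies in a ball U
    of radius h/2 of a minimal cover, then U is contained in B(z, h), so that U
    contributes at most K.  With the logarithmic bandwidth the cover has at most
    sqrt n balls, and K sqrt n is negligible with respect to h^beta. *)

(** * Measures on tuples, laws of random variables, and Chebyshev's inequality *)

Definition tuple_box (T : Type) (n : nat) (A : 'I_n -> set T) :
    set (n.-tuple T) :=
  \bigcap_(i in [set: 'I_n]) (@tnth n T ^~ i) @^-1` A i.

Lemma measurable_tuple_box (d : measure_display) (T : measurableType d)
    (n : nat) (A : 'I_n -> set T) :
  (forall i, measurable (A i)) -> measurable (tuple_box A).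
Proof.
move=> mA; apply: fin_bigcap_measurable; first exact: finite_finset.
move=> i _; rewrite -[X in measurable X]setTI.
exact: (measurable_tnth i).
Qed.

(** Boxes contain the whole space, are stable under intersection and generate the sigma-algebra of
    tuples, so they form a determining class for finite measures. *)
Lemma tuple_box_measure_unique (R : realType) (d : measure_display)
    (T : measurableType d) (n : nat) (m1 m2 : {measure set (n.-tuple T) -> \bar R}) :
  (m1 setT < +oo)%E ->
  (forall A : 'I_n -> set T, (forall i, measurable (A i)) ->
     m1 (tuple_box A) = m2 (tuple_box A)) ->
  forall A, measurable A -> m1 A = m2 A.
Proof.
move=> m1oo m12 A mA.
pose G : set (set (n.-tuple T)) := [set B | exists2 A : 'I_n -> set T,
  (forall i, measurable (A i)) & B = tuple_box A].
have boxT : tuple_box (fun _ : 'I_n => [set: T]) = setT.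
  by apply/seteqP; split.
apply: (measure_unique G (fun=> setT)) => //.
- apply/seteqP; split; last first.
    apply: smallest_sub; first exact: sigma_algebra_measurable.
    by move=> _ [B mB ->]; exact: measurable_tuple_box.
  apply: smallest_sub; first exact: smallest_sigma_algebra.
  rewrite -bigcup_seq; apply: bigcup_sub => i _ _ [B mB <-].
  apply: sub_sigma_algebra.
  (* The preimage of [B] under the coordinate [i] is the box whose other sides are the whole
     space. *)
  exists (fun j => if j == i then B else setT).
    by move=> j; case: ifP.
  apply/seteqP; split => t /=.
    by move=> [_ Bt] j _ /=; case: eqP => // ->.
  by move=> /(_ i I) /=; rewrite eqxx.
- move=> _ _ [B mB ->] [D mD ->].
  exists (fun i => B i `&` D i); first by move=> i; exact: measurableI.
  by rewrite /tuple_box -bigcapI.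
- by move=> _; exists (fun=> setT).
- by rewrite bigcup_const.
- by move=> _ [B mB ->]; exact: m12.
Qed.

Lemma exists_law (R : realType) (d d' : measure_display) (S : measurableType d)
    (T : measurableType d') (P : probability S R) (f : S -> T) :
  measurable_fun setT f ->
  exists tau : probability T R, forall A, tau A = P (f @^-1` A).
Proof.
move=> mf.
pose f' : {RV P >-> T} := HB.pack f (isMeasurableFun.Build _ _ _ _ _ mf).
by exists (distribution P f').
Qed.

Lemma exists_restricted_law (R : realType) (d d' : measure_display)
    (S : measurableType d) (T : measurableType d') (P : probability S R)
    (f : S -> T) (D : set S) :
  measurable_fun setT f -> measurable D ->
  exists tau : {measure set T -> \bar R},
    forall A, tau A = P (f @^-1` A `&` D).
Proof.
move=> mf mD.
by exists (pushforward (mrestr P mD) f).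
Unshelve. exact: mf.
Qed.

(** With [N] the count, the pointwise inequality t^2 1_bad <= (N - nq)^2 is integrated in the form
    t^2 1_bad + 2nq N <= N^2 + (nq)^2, where both sides are sums of nonnegative terms. Pairwise
    independence gives the second moment, and the variance nq(1 - q) is bounded by nq. *)
Lemma frequency_chebyshev (R : realType) (d : measure_display)
    (Omega : measurableType d) (P : probability Omega R) (n : nat)
    (E : 'I_n -> set Omega) (q t : R) :
  (forall j, measurable (E j)) -> (forall j, P (E j) = q%:E) ->
  (forall j k, j != k -> P (E j `&` E k) = (q * q)%:E) -> 0 < t ->
  (P [set o | (t <= `|\sum_(j < n) \1_(E j) o - n%:R * q|)%R] <=
     (n%:R * q / t ^+ 2)%:E)%E.
Proof.
have square_le (a x c : R) : a <= (x - c) ^+ 2 ->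
    a + 2 * c * x <= x ^+ 2 + c ^+ 2 by nra.
have final_le (a r m : R) : 0 <= m * (q * q) ->
    a * r + 2 * (m * q) * (m * q) <=
      m * q + (m * m - m) * q * q + (m * q) ^+ 2 -> r * a <= m * q by nra.
move=> mE PE PEE t0.
have q0 (j : 'I_n) : 0 <= q by rewrite -lee_fin -(PE j) measure_ge0.
(* For [n = 0] the hypotheses leave the sign of [q] open, but the product is 0. *)
have nq0 : 0 <= n%:R * q.
  case: n q0 {E mE PE PEE} => [|n] q0; first by rewrite mul0r.
  by rewrite mulr_ge0 // (q0 ord0).
set N : Omega -> R := fun o => \sum_(j < n) \1_(E j) o.
have N0 o : 0 <= N o by apply: sumr_ge0 => j _; rewrite indicE ler0n.
have nq20 : 0 <= 2 * (n%:R * q) by rewrite mulr_ge0.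
set bad := [set o | _].
have mN : measurable_fun setT N.
  apply: measurable_sum => j; exact: measurable_indic.
have mbad : measurable bad.
  have mf : measurable_fun setT (fun o => `|N o - n%:R * q|).
    apply: (measurableT_comp (@normr_measurable R setT)).
    exact: (measurable_funB mN (measurable_cst _)).
  have -> : bad = (fun o => `|N o - n%:R * q|) @^-1` `[t, +oo[.
    by apply/seteqP; split => o; rewrite /bad /= in_itv /= andbT.
  by rewrite -[X in measurable X]setTI; exact: mf.
have mc (c : R) (f : Omega -> R) :
    measurable_fun setT f -> measurable_fun setT (fun o => (c * f o)%:E).
  move=> mf; apply: (measurableT_comp (f := EFin) _ (g := fun o => c * f o)) => //.
  exact: (measurable_funM (measurable_cst c) mf).
have mi (A : set Omega) : measurable A ->
    measurable_fun setT (fun o => (\1_A o : R)%:E).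
  by move=> mA; apply: measurableT_comp => //; exact: measurable_indic.
have iE (A : set Omega) : measurable A -> (\int[P]_o (\1_A o)%:E = P A)%E.
  by move=> mA; rewrite integral_indic // setIT.
have icst (r : R) : (\int[P]_o r%:E = r%:E)%E.
  have := integral_cst P (@measurableT _ Omega) r%:E.
  rewrite /cst => ->; transitivity (r%:E * P setT)%E => //.
  by rewrite probability_setT mule1.
have mEE j k : measurable (E j `&` E k) by exact: measurableI.
have lhs : (\int[P]_o ((t ^+ 2 * \1_bad o)%:E + (2 * (n%:R * q) * N o)%:E) =
    (t ^+ 2)%:E * P bad + (2 * (n%:R * q) * (n%:R * q))%:E)%E.
  rewrite ge0_integralD //=; first last.
  - exact: mc.
  - by move=> o _; rewrite lee_fin mulr_ge0 ?N0.
  - by apply: mc => //; exact: measurable_indic.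
  - by move=> o _; rewrite lee_fin mulr_ge0 // exprn_ge0 // ltW.
  under eq_integral do rewrite EFinM.
  rewrite ge0_integralZl //=; first last.
  - by rewrite lee_fin exprn_ge0 // ltW.
  - exact: mi.
  rewrite iE //; congr (_ + _)%E.
  under eq_integral do rewrite EFinM.
  rewrite ge0_integralZl //=; first last.
  - by move=> o _; rewrite lee_fin N0.
  - exact: measurableT_comp.
  rewrite [RHS]EFinM; congr (_ * _)%E.
  under eq_integral do rewrite /N -sumEFin.
  rewrite ge0_integral_sum //=; first last.
  - by move=> j; exact: mi.
  under eq_bigr => j _ do rewrite iE // PE.
  by rewrite sumEFin sumr_const card_ord mulr_natl.
(* Here N^2 is expanded as a double sum of indicators of intersections: each row has one diagonal
   term of mass [q] and n - 1 terms of mass [q * q]. *)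
have rhs : (\int[P]_o (\sum_(j < n) \sum_(k < n) (\1_(E j `&` E k) o)%:E +
     ((n%:R * q) ^+ 2)%:E) =
    (n%:R * q + (n%:R * n%:R - n%:R) * q * q + (n%:R * q) ^+ 2)%:E)%E.
  rewrite ge0_integralD //=; first last.
  - by move=> o _; rewrite lee_fin sqr_ge0.
  - apply: emeasurable_sum => j; apply: emeasurable_sum => k.
    exact: mi.
  - by move=> o _; do 2 (apply: sume_ge0 => ? _); rewrite lee_fin.
  rewrite icst [RHS]EFinD; congr (_ + _)%E.
  rewrite ge0_integral_sum //=; first last.
  - by move=> j o _; apply: sume_ge0 => ? _; rewrite lee_fin.
  - move=> j; apply: emeasurable_sum => k.
    exact: mi.
  have inner j : (\int[P]_o (\sum_(k < n) (\1_(E j `&` E k) o)%:E) =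
      (q + (n%:R - 1) * (q * q))%:E)%E.
    rewrite ge0_integral_sum //=; first last.
    - move=> k.
      exact: mi.
    rewrite (eq_bigr (fun k => (if k == j then q else q * q)%:E)); last first.
      move=> k _; rewrite iE //.
      have [->|kj] := eqVneq k j; first by rewrite setIid PE.
      by rewrite PEE // eq_sym.
    rewrite sumEFin (bigD1 j) //= eqxx.
    rewrite (eq_bigr (fun=> q * q)); last by move=> k /negbTE ->.
    rewrite sumr_const cardC1 card_ord -[in LHS]mulr_natl -subn1 natrB //.
    exact: leq_ltn_trans (ltn_ord j).
  under eq_bigr do rewrite inner.
  by rewrite sumEFin sumr_const card_ord -mulr_natl; congr (_%:E); ring.
have le_int : (\int[P]_o ((t ^+ 2 * \1_bad o)%:E + (2 * (n%:R * q) * N o)%:E) <=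
    \int[P]_o (\sum_(j < n) \sum_(k < n) (\1_(E j `&` E k) o)%:E +
     ((n%:R * q) ^+ 2)%:E))%E.
  apply: ge0_le_integral => //=.
  - move=> o _; by rewrite -EFinD lee_fin addr_ge0 // mulr_ge0 ?N0 ?sqr_ge0.
  - by apply: emeasurable_funD; apply: mc => //; exact: measurable_indic.
  - apply: emeasurable_funD => //.
    apply: emeasurable_sum => j; apply: emeasurable_sum => k.
    exact: mi.
  - move=> o _.
    have -> : (\sum_(j < n) \sum_(k < n) (\1_(E j `&` E k) o)%:E =
        (N o ^+ 2)%:E :> \bar R)%E.
      under eq_bigr do rewrite sumEFin.
      rewrite sumEFin expr2 /N mulr_suml; congr (_%:E).
      apply: eq_bigr => j _; rewrite mulr_sumr; apply: eq_bigr => k _.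
      by rewrite indicI.
    rewrite -!EFinD lee_fin.
    apply: square_le; rewrite indicE; case: (boolP (o \in bad)) => [|_].
      rewrite inE /bad /= mulr1 => tN.
      by rewrite -[leRHS]real_normK ?num_real // lerXn2r // nnegrE // ltW.
    by rewrite mulr0 sqr_ge0.
move: le_int; rewrite lhs rhs.
have [r ->] : exists r, P bad = r%:E.
  by exists (fine (P bad)); rewrite fineK // fin_num_measure.
rewrite -EFinM -EFinD !lee_fin ler_pdivlMr ?exprn_gt0 //.
by apply: final_le; rewrite mulr_ge0 // -expr2 sqr_ge0.
Qed.

(** * Probabilities as real numbers *)

Section FineProbability.
Variables (R : realType) (d : measure_display) (T : measurableType d).
Variable P : probability T R.
Implicit Types A B : set T.

Lemma probability_fineE A : measurable A -> P A = (fine (P A))%:E.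
Proof. by move=> mA; rewrite fineK // fin_num_measure. Qed.

Lemma fine_probability_ge0 A : 0 <= fine (P A).
Proof. by apply: fine_ge0; exact: measure_ge0. Qed.

Lemma fine_probability_le A B : measurable A -> measurable B -> A `<=` B ->
  fine (P A) <= fine (P B).
Proof.
move=> mA mB AB; apply: fine_le; rewrite ?fin_num_measure //.
by apply: le_measure => //; rewrite inE.
Qed.

Lemma fine_probability_le1 A : measurable A -> fine (P A) <= 1.
Proof.
by move=> mA; rewrite -lee_fin -probability_fineE // probability_le1.
Qed.

Lemma fine_probabilityDI A B : measurable A -> measurable B ->
  fine (P A) = fine (P (A `\` B)) + fine (P (A `&` B)).
Proof.
move=> mA mB; rewrite -fineD ?fin_num_measure //; first by rewrite -measureDI.
- exact: measurableD.
- exact: measurableI.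
Qed.

Lemma fine_probabilityC A : measurable A -> fine (P (~` A)) = 1 - fine (P A).
Proof.
by move=> mA; rewrite probability_setC // fineB ?fin_num_measure.
Qed.

Lemma fine_probability_null A B : measurable A -> measurable B ->
  P B = 1%E -> fine (P (A `\` B)) = 0.
Proof.
move=> mA mB PB; apply/eqP; rewrite eq_le fine_probability_ge0 andbT.
have -> : 0 = fine (P (~` B)) by rewrite fine_probabilityC // PB /= subrr.
apply: fine_probability_le; [exact: measurableD|exact: measurableC|].
by move=> x [].
Qed.

End FineProbability.

(** * The density with respect to P_X + P_Y and the regret of a decision region *)

Section LikelihoodRatio.
Variables (R : realType) (d : measure_display) (T : measurableType d).
Variables (PX PY : probability T R) (p : T -> R).
Hypothesis mp : measurable_fun setT p.
Hypothesis PXp : forall A, measurable A ->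
  PX A = (\int[measure_add PX PY]_(x in A) (p x)%:E)%E.
Implicit Types A B : set T.

Let mpE A : measurable_fun A (fun x => (p x)%:E).
Proof.
by apply/measurable_EFinP; exact: measurable_funS mp.
Qed.

Lemma density_ge (r : R) A : 0 <= r -> measurable A ->
  (forall x, A x -> r <= p x) -> (r%:E * (PX A + PY A) <= PX A)%E.
Proof.
move=> r0 mA rp; rewrite [leRHS]PXp // -measure_addE -integral_cst //.
exact: ge0_le_integral.
Qed.

Lemma density_le (r : R) A : 0 <= r -> measurable A ->
  (forall x, A x -> p x <= r) -> (PX A <= r%:E * (PX A + PY A))%E.
Proof.
move=> r0 mA pr.
(* No sign of [p] is assumed. Where [p] is negative the integral is at most 0, so P_X vanishes
   there, and the comparison of nonnegative integrands applies on the rest. *)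
pose N : set T := p @^-1` `]-oo, 0[.
have mN : measurable N by rewrite -[N]setTI; exact: mp.
have eA : (PX A = PX (A `\` N) + PX (A `&` N))%E by exact: measureDI.
rewrite [leLHS]eA -(measure_addE PX PY A); have -> : (PX (A `&` N) = 0)%E.
  apply/eqP; rewrite eq_le measure_ge0 andbT.
  rewrite PXp; last exact: measurableI.
  have Np0 x : (A `&` N) x -> (0 <= (- p x)%:E)%E.
    by move=> [_]; rewrite /N /= in_itv /= lee_fin oppr_ge0 => /ltW.
  rewrite (eq_integral (fun x => - (- p x)%:E)%E); last first.
    by move=> x _; rewrite EFinN oppeK.
  by rewrite integral_ge0N // oppe_le0; exact: integral_ge0.
have mAN : measurable (A `\` N) by exact: measurableD.
rewrite adde0 PXp //.
apply: (@le_trans _ _ (r%:E * measure_add PX PY (A `\` N))%E).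
  rewrite -integral_cst //; apply: ge0_le_integral => //.
  - by move=> x [_ /negP]; rewrite /N /= in_itv /= -leNgt lee_fin.
  - by move=> x [Ax _]; rewrite lee_fin pr.
apply: lee_wpmul2l; first by rewrite lee_fin.
by apply: le_measure; rewrite ?inE // => x [].
Qed.

(** The function 2p - 1 is the density of P_X - P_Y with respect to P_X + P_Y. The bound [-1 <= c]
    makes the corresponding threshold (c + 1)/2 for [p] nonnegative. *)
Lemma likelihood_excess_ge (c : R) A : -1 <= c -> measurable A ->
  (forall x, A x -> c <= 2 * p x - 1) ->
  c * (fine (PX A) + fine (PY A)) <= fine (PX A) - fine (PY A).
Proof.
move=> c1 mA cp; have c0 : 0 <= (c + 1) / 2 by lra.
have := density_ge c0 mA.
rewrite (probability_fineE PX mA) (probability_fineE PY mA) /=.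
rewrite -EFinD -EFinM lee_fin => H.
have {H} := H _; have rp x : A x -> (c + 1) / 2 <= p x.
  by move=> /cp; lra.
by move=> /(_ rp); lra.
Qed.

Lemma likelihood_excess_le (c : R) A : -1 <= c -> measurable A ->
  (forall x, A x -> 2 * p x - 1 <= c) ->
  fine (PX A) - fine (PY A) <= c * (fine (PX A) + fine (PY A)).
Proof.
move=> c1 mA cp; have c0 : 0 <= (c + 1) / 2 by lra.
have := density_le c0 mA.
rewrite (probability_fineE PX mA) (probability_fineE PY mA) /=.
rewrite -EFinD -EFinM lee_fin => H.
have {H} := H _; have rp x : A x -> p x <= (c + 1) / 2.
  by move=> /cp; lra.
by move=> /(_ rp); lra.
Qed.

(** If class Y is chosen on [A], the risk is 1 + P_X(A) - P_Y(A), so this bounds the regret of [A].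
    A competitor [B] differs from [A] on [B \ A] and [A \ B]. On each of them the part with |2p - 1|
    <= k costs at most 2k, since P_X + P_Y has total mass 2, and the remaining loss is controlled by
    the part where [A] decides wrongly by a margin above k. *)
Lemma TV_le_regret (k : R) A : 0 <= k <= 1 -> measurable A ->
  (TV PX PY <= (fine (PY A) - fine (PX A) + 4 * k
     + fine (PX ([set z | (k < 2 * p z - 1)%R] `&` A))
     + fine (PY ([set z | (2 * p z - 1 < - k)%R] `\` A)))%:E)%E.
Proof.
move=> /andP[k0 k1] mA.
have Nk : -1 <= - k by lra.
have Nk' : -1 <= k by lra.
set Sp := [set z | (k < _)%R]; set Sm := [set z | (_ < - k)%R].
have mp2 : measurable_fun setT (fun z => 2 * p z - 1).
  have m2p := measurable_funM (measurable_cst (2 : R)) mp.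
  exact: (measurable_funB m2p (measurable_cst (1 : R))).
have mSp : measurable Sp.
  have -> : Sp = (fun z => 2 * p z - 1) @^-1` `]k, +oo[.
    by apply/seteqP; split => z; rewrite /Sp /= in_itv /= andbT.
  by rewrite -[X in measurable X]setTI; exact: mp2.
have mSm : measurable Sm.
  have -> : Sm = (fun z => 2 * p z - 1) @^-1` `]-oo, -k[.
    by apply/seteqP; split => z; rewrite /Sm /= in_itv.
  by rewrite -[X in measurable X]setTI; exact: mp2.
set rhs := (X in X%:E).
(* Applying a one-sided bound to [B] and to its complement yields the absolute value in the total
   variation. *)
suff dB B : measurable B -> fine (PY B) - fine (PX B) <= rhs.
  apply: ge_ereal_sup => _ [B /= mB <-].
  rewrite (probability_fineE PX mB) (probability_fineE PY mB) /= lee_fin.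
  have mCB : measurable (~` B) by exact: measurableC.
  rewrite ler_norml; have := dB _ mB; have := dB _ mCB.
  by rewrite !fine_probabilityC //; lra.
move=> mB.
have mBA : measurable (B `\` A) by exact: measurableD.
have mAB : measurable (A `\` B) by exact: measurableD.
have hBA : fine (PY (B `\` A)) - fine (PX (B `\` A)) <=
    fine (PY (Sm `\` A)) + 2 * k.
  have mD : measurable ((B `\` A) `\` Sm) by exact: measurableD.
  have mI : measurable ((B `\` A) `&` Sm) by exact: measurableI.
  rewrite (fine_probabilityDI PX mBA mSm) (fine_probabilityDI PY mBA mSm).
  have Hk : - k * (fine (PX (B `\` A `\` Sm)) + fine (PY (B `\` A `\` Sm))) <=
      fine (PX (B `\` A `\` Sm)) - fine (PY (B `\` A `\` Sm)).
    apply: likelihood_excess_ge => //.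
    by move=> z [_ /negP]; rewrite -leNgt.
  have h1 := fine_probability_le1 PX mD; have h2 := fine_probability_le1 PY mD.
  have h3 := fine_probability_ge0 PX ((B `\` A) `&` Sm).
  have : fine (PY ((B `\` A) `&` Sm)) <= fine (PY (Sm `\` A)).
    by apply: fine_probability_le; [|exact: measurableD|move=> z [[_ ?] ?]].
  nra.
have hAB : fine (PX (A `\` B)) - fine (PY (A `\` B)) <=
    fine (PX (Sp `&` A)) + 2 * k.
  have mD : measurable ((A `\` B) `\` Sp) by exact: measurableD.
  have mI : measurable ((A `\` B) `&` Sp) by exact: measurableI.
  rewrite (fine_probabilityDI PX mAB mSp) (fine_probabilityDI PY mAB mSp).
  have Hk : fine (PX (A `\` B `\` Sp)) - fine (PY (A `\` B `\` Sp)) <=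
      k * (fine (PX (A `\` B `\` Sp)) + fine (PY (A `\` B `\` Sp))).
    apply: likelihood_excess_le => //.
    by move=> z [_ /negP]; rewrite -leNgt.
  have h1 := fine_probability_le1 PX mD; have h2 := fine_probability_le1 PY mD.
  have h3 := fine_probability_ge0 PY ((A `\` B) `&` Sp).
  have : fine (PX ((A `\` B) `&` Sp)) <= fine (PX (Sp `&` A)).
    by apply: fine_probability_le; [|exact: measurableI|move=> z [[? _] ?]].
  nra.
have e1 := fine_probabilityDI PY mB mA; have e2 := fine_probabilityDI PX mB mA.
have e3 := fine_probabilityDI PY mA mB; have e4 := fine_probabilityDI PX mA mB.
rewrite setIC in e3; rewrite setIC in e4.
by rewrite /rhs; lra.
Qed.

(** No region beats the risk 1 - TV; this is what makes the excess risk nonnegative later. *)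
Lemma regret_ge0 A : measurable A ->
  ((fine (PY A) - fine (PX A))%:E <= TV PX PY)%E.
Proof.
move=> mA; apply: le_trans (ereal_sup_ubound _); last by exists A; [exact: mA|].
rewrite (probability_fineE PX mA) (probability_fineE PY mA) /= lee_fin.
by rewrite distrC ler_norm.
Qed.

End LikelihoodRatio.

(** * Measurability of balls and of the distance in a separable metric space *)

Lemma countable_bigcup_measurable (d : measure_display)
    (T : measurableType d) (U : Type)
    (D : set U) (F : U -> set T) : countable D ->
  (forall q, D q -> measurable (F q)) -> measurable (\bigcup_(q in D) F q).
Proof.
move=> /countable_injP[f finj] mF.
pose G (n : nat) := \bigcup_(q in [set q | D q /\ f q = n]) F q.
have -> : \bigcup_(q in D) F q =
    \bigcup_n G n.
  apply/seteqP; split => [z [q Dq Fz]|z [n _ [q [Dq _] Fz]]].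
    by exists (f q) => //; exists q.
  by exists q.
apply: bigcupT_measurable => n; rewrite /G.
have [[q [Dq fq]]|nq] := pselect (exists q, D q /\ f q = n).
  have -> : [set q | D q /\ f q = n] = [set q].
    apply/seteqP; split => [q' [Dq' fq']|_ -> //] /=.
    by apply: finj; rewrite ?inE // fq fq'.
  by rewrite bigcup_set1; exact: mF.
rewrite (_ : [set q | _] = set0) ?bigcup_set0 //.
by apply/seteqP; split => // q Dq; apply: nq; exists q.
Qed.

Section MetricMeasurability.
Variables (R : realType) (d : measure_display) (X : measurableType d).
Variable rho : X -> X -> R.
Hypothesis rho_metric : is_metric rho.
Hypothesis rho_sep : rho_separable rho.
Hypothesis borel : @measurable d X = <<s rho_open rho >>.

Lemma measurable_rball x e : measurable (rball rho x e).
Proof.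
rewrite borel; apply: sub_sigma_algebra => y; rewrite /rball /= => xye.
exists (e - rho x y); first by rewrite subr_gt0.
move=> z /= yz; case: rho_metric => _ [_ [_ tri]].
by apply: le_lt_trans (tri x y z) _; rewrite addrC -ltrBrDr.
Qed.

(* For a dense countable set of centres [q], [rho x y < e] holds iff
   [rho x q < r] and [rho q y < e - r] for some [q] and some rational [r]. *)
Lemma measurable_rho_lt (e : R) :
  measurable [set xy : X * X | rho xy.1 xy.2 < e].
Proof.
case: rho_sep => D [cD dense]; case: rho_metric => _ [_ [sym tri]].
rewrite (_ : [set _ | _] = \bigcup_(q in D) \bigcup_(r : rat)
    (rball rho q (ratr r) `*` rball rho q (e - ratr r))); last first.
  apply/seteqP; split => [[x y] /= xye|[x y] [q _ [r _ [/= qx qy]]]].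
    pose t := (e - rho x y) / 3.
    have t0 : 0 < t by rewrite /t; lra.
    have [q Dq xq] := dense x t t0.
    have /rat_in_itvoo[r] : t < 2 * t by lra.
    rewrite in_itv /= => /andP[tr r2t].
    exists q => //; exists r => //; split; rewrite /rball /=.
      by rewrite sym; exact: lt_trans tr.
    have := tri q x y; rewrite (sym q x); move: xq r2t; rewrite /t; lra.
  move: qx qy; rewrite /rball /= => qx qy.
  have := tri x q y; rewrite (sym x q); lra.
apply: countable_bigcup_measurable => // q _.
apply: bigcupT_measurable_rat => r.
by apply: measurableX; exact: measurable_rball.
Qed.

End MetricMeasurability.

(** * The law of the training sample and its independence of the new observation *)

Section ClassificationModel.
Variables (R : realType) (d : measure_display) (X : measurableType d).
Variables (n : nat) (w : R) (PX PY : probability X R).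

Definition labelled_law (A : set (X * bool)) : \bar R :=
  ((1 - w)%:E * PX [set x | A (x, false)] + w%:E * PY [set x | A (x, true)])%E.

Lemma measurable_label (b : bool) (A : set (X * bool)) :
  measurable A -> measurable [set x | A (x, b)].
Proof.
move=> mA; have -> : [set x | A (x, b)] = ysection A b.
  by apply/seteqP; split => x; rewrite /ysection /= inE.
exact: measurable_ysection.
Qed.

Section OneModel.
Variables (dO : measure_display) (Omega : measurableType dO).
Variables (P : probability Omega R) (Zs : 'I_n -> Omega -> X).
Variables (Ws : 'I_n -> Omega -> bool) (Z : Omega -> X) (PZ : probability X R).
Hypothesis model : classification_model P w PX PY Zs Ws Z PZ.

Definition training_tuple (o : Omega) : n.-tuple (X * bool) :=
  [tuple (Zs j o, Ws j o) | j < n].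

Lemma measurable_observation j : measurable_fun setT (fun o => (Zs j o, Ws j o)).
Proof. by case: model => -[mZ mW] _ _ _ _; exact: measurable_fun_pair. Qed.

Lemma measurable_training_tuple : measurable_fun setT training_tuple.
Proof.
apply/measurable_fun_tnthP => j.
rewrite (_ : _ \o _ = fun o => (Zs j o, Ws j o)); first exact: measurable_observation.
by apply/funext => o /=; rewrite tnth_mktuple.
Qed.

(** The model prescribes the law on products of a set with a single label; a general measurable set
    is split into its two label slices. *)
Lemma observation_law j (A : set (X * bool)) : measurable A ->
  P ((fun o => (Zs j o, Ws j o)) @^-1` A) = labelled_law A.
Proof.
move=> mA; have mb b := measurable_label b mA.
case: model => -[mZ mW] _ _ law _.
have [lawF _] := law j _ (mb false); have [_ lawT] := law j _ (mb true).
rewrite /labelled_law -lawF -lawT.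
have mE b : measurable ([set o | Zs j o \in [set x | A (x, b)]] `&`
    [set o | Ws j o = b]).
  apply: measurableI; last first.
    by rewrite -[X in measurable X]setTI; exact: (mW j measurableT [set b]).
  rewrite (_ : [set o | _] = Zs j @^-1` [set x | A (x, b)]); last first.
    by apply/seteqP; split => o /=; rewrite inE.
  by rewrite -[X in measurable X]setTI; exact: mZ.
rewrite -measureU //; last first.
  by apply/seteqP; split => // o [[_ /= ->] [_ /=]].
congr (P _); apply/seteqP; split => o /=.
  by case: (Ws j o) => ?; [right|left]; split => //; rewrite inE.
by case=> -[]; rewrite inE /= => ? ->.
Qed.

Lemma box_law (A : 'I_n -> set (X * bool)) (B : set X) :
  (forall j, measurable (A j)) -> measurable B ->
  P (training_tuple @^-1` tuple_box A `&` Z @^-1` B) =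
    ((\prod_(j < n) labelled_law (A j)) * PZ B)%E.
Proof.
move=> mA mB; case: (model) => _ mZ indep _ lawZ.
(* The side for the index [None] leaves the dummy label free, so its factor is the law of [Z]. *)
pose A' (i : option 'I_n) := if i is Some j then A j else B `*` [set: bool].
have mA' i : measurable (A' i).
  by case: i => [j|] //=; exact: measurableX.
have := indep A' mA'.
rewrite (bigD1 None) //= (reindex_omap Some id) /=; last by case.
rewrite (eq_bigl xpredT); last by move=> j; rewrite eqxx.
rewrite (eq_bigr (fun j => labelled_law (A j))); last first.
  by move=> j _; rewrite -(observation_law j (mA j)).
rewrite (_ : P ((fun o => (Z o, false)) @^-1` (B `*` [set: bool])) = PZ B); last first.
  by rewrite -lawZ //; congr (P _); apply/seteqP; split => o //= [].
rewrite muleC => <-; congr (P _); apply/seteqP; split => o.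
  move=> [box ZB] [j|] _ //=; have := box j I.
  by rewrite /= tnth_mktuple.
move=> all; split; last by have [] := all None I.
by move=> j _ /=; rewrite tnth_mktuple; exact: (all (Some j) I).
Qed.

Lemma training_box_law (A : 'I_n -> set (X * bool)) :
  (forall j, measurable (A j)) ->
  P (training_tuple @^-1` tuple_box A) = (\prod_(j < n) labelled_law (A j))%E.
Proof.
move=> mA; have := box_law mA measurableT.
by rewrite preimage_setT setIT probability_setT mule1.
Qed.

Lemma observation_count_deviation (E : set (X * bool)) (q t : R) :
  measurable E -> labelled_law E = q%:E -> 0 < t ->
  (P [set o | (t <= `|\sum_(j < n) \1_E (Zs j o, Ws j o) - n%:R * q|)%R] <=
     (n%:R * q / t ^+ 2)%:E)%E.
Proof.
move=> mE Eq t0.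
pose F j := (fun o => (Zs j o, Ws j o)) @^-1` E.
have mF j : measurable (F j).
  by rewrite -[F j]setTI; exact: measurable_observation.
apply: (le_trans _ (@frequency_chebyshev _ _ _ P n F q t mF _ _ t0)).
- exact: lexx.
- by move=> j; rewrite -Eq -(observation_law j mE).
move=> j k jk.
(* Pairwise independence is the box formula with only two nontrivial sides; every other factor
   equals (1 - w) + w = 1. *)
pose A i := if (i == j) || (i == k) then E else setT.
have mA i : measurable (A i) by rewrite /A; case: ifP.
have -> : F j `&` F k = training_tuple @^-1` tuple_box A.
  apply/seteqP; split => o.
    move=> [Fj Fk] i _ /=; rewrite tnth_mktuple /A.
    by case: eqP => [->//|_] /=; case: eqP => [->|].
  move=> all; split; [have := all j I|have := all k I];
    by rewrite /= tnth_mktuple /A eqxx ?orbT.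
rewrite training_box_law // (bigD1 j) //= (bigD1 k) 1?eq_sym //=.
rewrite big1 => [|i /andP[ij ik]]; last first.
  rewrite /A (negbTE ij) (negbTE ik) /= /labelled_law.
  have sT b : [set x : X | [set: X * bool] (x, b)] = setT by apply/seteqP.
  by rewrite !sT !probability_setT !mule1 -EFinD subrK.
by rewrite /A !eqxx orbT /= Eq mule1 -EFinM.
Qed.

End OneModel.

(** Uniqueness is used twice: rectangles determine the joint law, and for a fixed side [B] the boxes
    determine the dependence on the training set. Only the box values of [tau] are prescribed, so
    one and the same [tau] serves models on different probability spaces. *)
Lemma joint_law_product (dO : measure_display) (Omega : measurableType dO)
    (P : probability Omega R) Zs Ws Z PZ
    (tau : probability (n.-tuple (X * bool)%type) R) :
  classification_model P w PX PY Zs Ws Z PZ ->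
  (forall A : 'I_n -> set (X * bool), (forall j, measurable (A j)) ->
    tau (tuple_box A) = (\prod_(j < n) labelled_law (A j))%E) ->
  forall F : set (X * n.-tuple (X * bool)), measurable F ->
  P ((fun o => (Z o, training_tuple Zs Ws o)) @^-1` F) = (PZ \x tau)%E F.
Proof.
move=> model tau_box F mF.
have mT := measurable_training_tuple model.
have [_ mZ _ _ lawZ] := model.
have [nu nuE] := exists_law P (measurable_fun_pair mZ mT).
rewrite -nuE; apply/esym; apply: product_measure_unique => // B A mB mA.
have mZB : measurable (Z @^-1` B) by rewrite -[X in measurable X]setTI; exact: mZ.
have [m1 m1E] := exists_restricted_law P mT mZB.
have PZB0 : 0 <= fine (PZ B) by exact: fine_probability_ge0.
pose m2 : {measure set _ -> \bar R} := mscale (NngNum PZB0) tau.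
transitivity (P (training_tuple Zs Ws @^-1` A `&` Z @^-1` B)).
  by rewrite setIC; exact: nuE.
rewrite -m1E; transitivity (m2 A); last first.
  by rewrite /m2 /= /mscale /= -probability_fineE.
apply: tuple_box_measure_unique mA.
- by rewrite m1E preimage_setT setTI ltey_eq fin_num_measure.
- move=> C mC; rewrite m1E (box_law model) // -tau_box //.
  by rewrite /m2 /= /mscale /= -probability_fineE // muleC.
Qed.

End ClassificationModel.

(** * The kernel classifier as a comparison of empirical frequencies *)

Lemma empirical_ratio_lt (R : realFieldType) (u v a b e SX SY NX NY : R) :
  0 < u -> 0 < v -> 0 <= a -> 0 <= b -> 0 < a + b -> 0 < e -> e < 1 ->
  3 * e * (a + b) < a - b ->
  `|SX - u * a| < e * u * (a + b) -> `|SY - v * b| < e * v * (a + b) ->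
  `|NX - u| < e * u -> `|NY - v| < e * v ->
  [/\ 0 < NX, 0 < NY & SY / NY < SX / NX].
Proof.
move=> u0 v0 a0 b0 m0 e0 e1 gap.
rewrite !ltr_norml => /andP[SXl _] /andP[_ SYu] /andP[NXl NXu] /andP[NYl NYu].
have NX0 : 0 < NX by nra.
have NY0 : 0 < NY by nra.
(* With m = a + b, the chain is SY/NY < (b + em)/(1 - e) < (a - em)/(1 + e) < SX/NX. After clearing
   denominators the middle inequality is exactly 3em < a - b. *)
split => //; apply: (@lt_trans _ _ ((b + e * (a + b)) / (1 - e))).
  rewrite ltr_pdivrMr // mulrAC ltr_pdivlMr ?subr_gt0 //.
  apply: (@lt_trans _ _ (v * (b + e * (a + b)) * (1 - e))).
    by rewrite ltr_pM2r ?subr_gt0 //; lra.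
  rewrite -mulrA [v * _]mulrC -mulrA ltr_pM2l; first lra.
  by rewrite ltr_wpDl // mulr_gt0.
apply: (@lt_trans _ _ ((a - e * (a + b)) / (1 + e))).
  rewrite ltr_pdivrMr ?subr_gt0 // mulrAC ltr_pdivlMr ?addr_gt0 //.
  lra.
have am : 0 < a - e * (a + b) by nra.
rewrite ltr_pdivrMr ?addr_gt0 // mulrAC ltr_pdivlMr //.
apply: (@lt_trans _ _ ((a - e * (a + b)) * (u * (1 + e)))).
  by rewrite ltr_pM2l //; lra.
rewrite mulrA ltr_pM2r ?addr_gt0 //; lra.
Qed.

Section KernelClassifier.
Variables (R : realType) (T : Type) (rho : T -> T -> R).
Hypothesis rho_ge0 : forall x y, 0 <= rho x y.

Lemma Kind_div (r h : R) : 0 <= r -> 0 < h -> Kind (r / h) = (r < h)%R%:R.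
Proof.
move=> r0 h0; rewrite /Kind divr_ge0 ?(ltW h0) //= ltr_pdivrMr // mul1r.
by case: ifP.
Qed.

Lemma n0E n (ws : 'I_n -> bool) : (n0 ws)%:R = \sum_(j < n) (~~ ws j)%:R :> R.
Proof.
rewrite /n0 -sum1_card natr_sum big_mkcond /=.
apply: eq_bigr => j _; have -> : (j \in [set j | ~~ ws j]) = ~~ ws j by exact: asboolb.
by case: (ws j).
Qed.

Lemma n1E n (ws : 'I_n -> bool) : (n1 ws)%:R = \sum_(j < n) (ws j)%:R :> R.
Proof.
rewrite /n1 -sum1_card natr_sum big_mkcond /=.
apply: eq_bigr => j _; have -> : (j \in [set j | ws j]) = ws j by exact: asboolb.
by case: (ws j).
Qed.

(** Each pair of bits records nearness and label. The classifier itself is evaluated on an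
    artificial distance, 0 for a near point and 1 for a far one, with bandwidth 1, so its formula
    need not be restated. *)
Definition config_phi n (b : {ffun 'I_n -> bool * bool}) : bool :=
  phi (fun _ r : R => r) 1 (fun j => (~~ (b j).1)%:R) (fun j => (b j).2) 0.

(* The classifier depends on the data only through the finitely many bits
   [rho z (zs j) < h] and [ws j]; measurability reduces to these bits. *)
Lemma phi_configE n (h : R) (zs : 'I_n -> T) (ws : 'I_n -> bool) z : 0 < h ->
  phi rho h zs ws z = config_phi [ffun j => (rho z (zs j) < h, ws j)].
Proof.
move=> h0.
have K j : Kind (rho z (zs j) / h) =
    Kind ((~~ ([ffun j => (rho z (zs j) < h, ws j)] j).1)%:R / 1 : R).
  rewrite !Kind_div // ffunE /=; by case: ltP => _ /=; rewrite ?ltr01 ?ltxx.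
rewrite /config_phi /phi /pX_hat /pY_hat.
have -> : (fun j => ([ffun j => (rho z (zs j) < h, ws j)] j).2) = ws.
  by apply/funext => j; rewrite ffunE.
congr (_ < _); case: ifP => // _; congr (_ / _); apply: eq_bigr => j _;
  by rewrite K ffunE.
Qed.

Lemma pX_hatE n h (zs : 'I_n -> T) (ws : 'I_n -> bool) z : 0 < h ->
  0 < (n0 ws)%:R :> R ->
  pX_hat rho h zs ws z =
    (\sum_(j < n) \1_(rball rho z h `*` [set false]) (zs j, ws j)) /
    (n0 ws)%:R.
Proof.
move=> h0; rewrite /pX_hat ltr0n; case: eqP => [-> //|_ _].
congr (_ / _); apply: eq_bigr => j _; rewrite Kind_div // indicE.
case: (boolP ((zs j, ws j) \in _)); rewrite ?inE ?notin_setE /rball /=.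
  by move=> [-> ->]; rewrite subr0 mulr1.
by case: (ws j); case: ltP => //= _; rewrite ?subrr ?mul0r ?mulr0 // => -[].
Qed.

Lemma pY_hatE n h (zs : 'I_n -> T) (ws : 'I_n -> bool) z : 0 < h ->
  0 < (n1 ws)%:R :> R ->
  pY_hat rho h zs ws z =
    (\sum_(j < n) \1_(rball rho z h `*` [set true]) (zs j, ws j)) /
    (n1 ws)%:R.
Proof.
move=> h0; rewrite /pY_hat ltr0n; case: eqP => [-> //|_ _].
congr (_ / _); apply: eq_bigr => j _; rewrite Kind_div // indicE.
case: (boolP ((zs j, ws j) \in _)); rewrite ?inE ?notin_setE /rball /=.
  by move=> [-> ->]; rewrite mulr1.
by case: (ws j); case: ltP => //= _; rewrite ?mul0r ?mulr0 // => -[].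
Qed.

End KernelClassifier.

(** The four Chebyshev bounds are added. With m = a + b <= 2, the two terms of one class satisfy c +
    m^2 <= 3m for c = a or b, and 1/(1 - w) + 1/w = 1/(w(1 - w)) combines the classes. *)
Lemma deviation_terms_le (R : realFieldType) (w a b e u v : R) (n : nat) :
  u = n%:R * (1 - w) -> v = n%:R * w ->
  0 < w < 1 -> 0 <= a <= 1 -> 0 <= b <= 1 -> 0 < a + b -> 0 < e -> (0 < n)%N ->
  u * a / (e * u * (a + b)) ^+ 2 + v * b / (e * v * (a + b)) ^+ 2 +
    (u / (e * u) ^+ 2 + v / (e * v) ^+ 2) <=
  3 / (w * (1 - w)) / (e ^+ 2 * n%:R) / (a + b).
Proof.
move=> uE vE /andP[w0 w1] /andP[a0 a1] /andP[b0 b1]; set m := a + b => m0 e0 n_gt0.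
have N0 : 0 < n%:R :> R by rewrite ltr0n.
have u0 : 0 < u by rewrite uE mulr_gt0 // subr_gt0.
have v0 : 0 < v by rewrite vE mulr_gt0.
have aux x c : 0 < x -> c <= m ->
    x * c / (e * x * m) ^+ 2 + x / (e * x) ^+ 2 <= 3 / (e ^+ 2 * x * m).
  move=> x0 cm.
  have -> : x * c / (e * x * m) ^+ 2 + x / (e * x) ^+ 2 =
      (c + m ^+ 2) / m / (e ^+ 2 * x * m).
    by field; rewrite !gt_eqF.
  have D0 : 0 < e ^+ 2 * x * m by rewrite !mulr_gt0 // exprn_gt0.
  rewrite ler_pM2r ?invr_gt0 // ler_pdivrMr //.
  have : m <= 2 by rewrite /m; lra.
  nra.
have am : a <= m by rewrite /m; lra.
have bm : b <= m by rewrite /m; lra.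
have := aux u a u0 am; have := aux v b v0 bm.
have -> : 3 / (w * (1 - w)) / (e ^+ 2 * n%:R) / m =
    3 / (e ^+ 2 * u * m) + 3 / (e ^+ 2 * v * m).
  rewrite uE vE; field.
  by rewrite !gt_eqF // subr_gt0.
lra.
Qed.

(** * The error probability of the classifier at a fixed point *)

Section Misclassification.
Variables (R : realType) (d : measure_display) (X : measurableType d).
Variable rho : X -> X -> R.
Hypothesis rho_metric : is_metric rho.
Hypothesis rho_sep : rho_separable rho.
Hypothesis borel : @measurable d X = <<s rho_open rho >>.
Variables (n : nat) (w h : R).
Hypotheses (w01 : 0 < w < 1) (h0 : 0 < h) (n_gt0 : (0 < n)%N).

Let rho_ge0 x y : 0 <= rho x y. Proof. by case: rho_metric => H _; exact: H. Qed.

Definition decision_set : set (X * n.-tuple (X * bool)) :=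
  [set zt | phi rho h (fun j => (tnth zt.2 j).1) (fun j => (tnth zt.2 j).2) zt.1].

Lemma measurable_decision_set : measurable decision_set.
Proof.
pose M (j : 'I_n) : set (X * n.-tuple (X * bool)) :=
  [set zt | rho zt.1 (tnth zt.2 j).1 < h].
pose L (j : 'I_n) : set (X * n.-tuple (X * bool)) :=
    [set zt | (tnth zt.2 j).2 = true].
have mtn j : measurable_fun setT
    (fun zt : X * n.-tuple (X * bool) => tnth zt.2 j).
  exact: (measurableT_comp (measurable_tnth j) measurable_snd).
have mM j : measurable (M j).
  have mf : measurable_fun setT
      (fun zt : X * n.-tuple (X * bool) => (zt.1, (tnth zt.2 j).1)).
    apply: measurable_fun_pair; first exact: measurable_fst.
    exact: (measurableT_comp measurable_fst (mtn j)).
  rewrite -[M j]setTI.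
  exact: (mf measurableT _ (measurable_rho_lt rho_metric rho_sep borel h)).
have mL j : measurable (L j).
  have mf := measurableT_comp measurable_snd (mtn j).
  by rewrite -[L j]setTI; exact: (mf measurableT [set true]).
have mif (A : set (X * n.-tuple (X * bool))) (c : bool) :
    measurable A -> measurable (if c then A else ~` A).
  by case: c => // mA; exact: measurableC.
(* The decision set is a finite union, over the bit configurations with answer 1, of finite
   intersections of measurable sets. *)
have -> : decision_set = \bigcup_(b in [set b | config_phi R b])
    \bigcap_(j in [set: 'I_n]) ((if (b j).1 then M j else ~` M j) `&`
      (if (b j).2 then L j else ~` L j)).
  apply/seteqP; split => [[z t]|[z t] [b bphi all]].
    rewrite /decision_set /= phi_configE // => H; eexists; first exact: H.
    move=> j _; rewrite ffunE /=; split; last first.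
      by case: ifP => //; rewrite /L /= => ->.
    by case: ifP => //; rewrite /M /= => ->.
  rewrite /decision_set /= phi_configE //.
  rewrite (_ : [ffun j => _] = b) //; apply/ffunP => j; rewrite ffunE.
  have := all j I; case: (b j) => -[] [] /= [].
  - by rewrite /M /L /= => -> ->.
  - by rewrite /M /L /= => -> /negP/negbTE ->.
  - by rewrite /M /L /= => /negP/negbTE -> ->.
  - by rewrite /M /L /= => /negP/negbTE -> /negP/negbTE ->.
apply: fin_bigcup_measurable; first exact: finite_finset.
move=> b _; apply: fin_bigcap_measurable; first exact: finite_finset.
by move=> j _; apply: measurableI; exact: mif.
Qed.

Variables (PX PY : probability X R).
Variables (dO : measure_display) (Omega : measurableType dO).
Variables (P : probability Omega R) (Zs : 'I_n -> Omega -> X).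
Variables (Ws : 'I_n -> Omega -> bool) (Z : Omega -> X) (PZ : probability X R).
Hypothesis model : classification_model P w PX PY Zs Ws Z PZ.

Lemma decision_setE z o : decision_set (z, training_tuple Zs Ws o) =
  phi rho h (Zs ^~ o) (Ws ^~ o) z :> Prop.
Proof.
rewrite /decision_set /=; congr (is_true (phi _ _ _ _ _)); apply/funext => j;
  by rewrite tnth_mktuple.
Qed.

Let count (E : set (X * bool)) o : R := \sum_(j < n) \1_E (Zs j o, Ws j o).

Let measurable_deviation E t q : measurable E ->
  measurable [set o | t <= `|count E o - n%:R * q|].
Proof.
move=> mE.
have mS : measurable_fun setT (count E).
  apply: measurable_sum => j.
  exact: (measurableT_comp (measurable_indic mE) (measurable_observation model j)).
have mc := measurable_funB mS (measurable_cst (n%:R * q : R)).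
have mf := measurableT_comp (@normr_measurable R setT) mc.
have -> : [set o | t <= `|count E o - n%:R * q|] =
    (fun o => `|count E o - n%:R * q|) @^-1` `[t, +oo[.
  by apply/seteqP; split => o; rewrite /= in_itv /= andbT.
by rewrite -[X in measurable X]setTI; exact: mf.
Qed.

Lemma labelled_law_false B : measurable B ->
  labelled_law w PX PY (B `*` [set false]) = ((1 - w) * fine (PX B))%:E.
Proof.
move=> mB; rewrite /labelled_law.
rewrite (_ : [set x | _ (x, false)] = B); last by apply/seteqP; split => x // [].
rewrite (_ : [set x | _ (x, true)] = set0); last by apply/seteqP; split => x // [].
by rewrite measure0 mule0 adde0 EFinM -probability_fineE.
Qed.

Lemma labelled_law_true B : measurable B ->
  labelled_law w PX PY (B `*` [set true]) = (w * fine (PY B))%:E.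
Proof.
move=> mB; rewrite /labelled_law.
rewrite (_ : [set x | _ (x, false)] = set0); last by apply/seteqP; split => x // [].
rewrite (_ : [set x | _ (x, true)] = B); last by apply/seteqP; split => x // [].
by rewrite measure0 mule0 add0e EFinM -probability_fineE.
Qed.

Lemma good_event (z : X) (e : R) :
  let B := rball rho z h in let a := fine (PX B) in let b := fine (PY B) in
  0 < a + b -> 0 < e -> e < 1 ->
  exists2 D : set Omega, measurable D /\
    (P D <= (3 / (w * (1 - w)) / (e ^+ 2 * n%:R) / (a + b))%:E)%E &
  forall o, ~ D o ->
    (3 * e * (a + b) < a - b -> ~~ phi rho h (Zs ^~ o) (Ws ^~ o) z) /\
    (3 * e * (a + b) < b - a -> phi rho h (Zs ^~ o) (Ws ^~ o) z).
Proof.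
move=> B a b m0 e0 e1.
have mB : measurable B by exact: measurable_rball.
have /andP[w0 w1] := w01.
pose u := n%:R * (1 - w); pose v := n%:R * w.
have N0 : 0 < n%:R :> R by rewrite ltr0n.
have u0 : 0 < u by rewrite /u mulr_gt0 // subr_gt0.
have v0 : 0 < v by rewrite mulr_gt0.
have a0 : 0 <= a by exact: fine_probability_ge0.
have b0 : 0 <= b by exact: fine_probability_ge0.
have a1 : a <= 1 by exact: fine_probability_le1.
have b1 : b <= 1 by exact: fine_probability_le1.
pose dev E t q : set Omega := [set o | t <= `|count E o - n%:R * q|].
have mE (C : set X) (c : bool) : measurable C -> measurable (C `*` [set c]).
  by move=> mC; exact: measurableX.
(* The bad event collects the deviations of the two local counts and of the two class sizes. The
   thresholds for the local counts scale with the mass a + b of the ball, which makes the final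
   bound of order 1/(a + b). *)
pose D1 := dev (B `*` [set false]) (e * u * (a + b)) ((1 - w) * a).
pose D2 := dev (B `*` [set true]) (e * v * (a + b)) (w * b).
pose D3 := dev (setT `*` [set false]) (e * u) (1 - w).
pose D4 := dev (setT `*` [set true]) (e * v) w.
have mD1 : measurable D1 by apply: measurable_deviation; exact: mE.
have mD2 : measurable D2 by apply: measurable_deviation; exact: mE.
have mD3 : measurable D3 by apply: measurable_deviation; exact: mE.
have mD4 : measurable D4 by apply: measurable_deviation; exact: mE.
have PD1 : (P D1 <= (u * a / (e * u * (a + b)) ^+ 2)%:E)%E.
  rewrite -[u * a]mulrA; apply: (observation_count_deviation model) => //.
  - exact: mE.
  - exact: labelled_law_false.
  - by rewrite mulr_gt0 // mulr_gt0.
have PD2 : (P D2 <= (v * b / (e * v * (a + b)) ^+ 2)%:E)%E.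
  rewrite -[v * b]mulrA; apply: (observation_count_deviation model) => //.
  - exact: mE.
  - exact: labelled_law_true.
  - by rewrite mulr_gt0 // mulr_gt0.
have PD3 : (P D3 <= (u / (e * u) ^+ 2)%:E)%E.
  apply: (observation_count_deviation model) => //.
  - exact: mE.
  - by rewrite labelled_law_false // probability_setT mulr1.
  - by rewrite mulr_gt0.
have PD4 : (P D4 <= (v / (e * v) ^+ 2)%:E)%E.
  apply: (observation_count_deviation model) => //.
  - exact: mE.
  - by rewrite labelled_law_true // probability_setT mulr1.
  - by rewrite mulr_gt0.
have mD12 : measurable (D1 `|` D2) by exact: measurableU.
have mD34 : measurable (D3 `|` D4) by exact: measurableU.
exists ((D1 `|` D2) `|` (D3 `|` D4)).
  split; first exact: measurableU.
  apply: (@le_trans _ _ ((u * a / (e * u * (a + b)) ^+ 2 +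
      v * b / (e * v * (a + b)) ^+ 2 +
      (u / (e * u) ^+ 2 + v / (e * v) ^+ 2))%:E)); last first.
    by rewrite lee_fin deviation_terms_le // ?a0 ?b0.
  rewrite !EFinD; apply: le_trans (measureU2 _ _ _) _ => //.
  by apply: leeD; apply: le_trans (measureU2 _ _ _) _ => //; exact: leeD.
move=> o nD.
have [nD1 nD2 nD3 nD4] : [/\ ~ D1 o, ~ D2 o, ~ D3 o & ~ D4 o].
  by split => H; apply: nD; [left; left|left; right|right; left|right; right].
have lt1 : `|count (B `*` [set false]) o - u * a| < e * u * (a + b).
  by rewrite ltNge -[u * a]mulrA; apply/negP.
have lt2 : `|count (B `*` [set true]) o - v * b| < e * v * (a + b).
  by rewrite ltNge -[v * b]mulrA; apply/negP.
have cF : count (setT `*` [set false]) o = (n0 (Ws ^~ o))%:R.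
  rewrite n0E; apply: eq_bigr => j _; rewrite indicE.
  case: (boolP (_ \in _)); rewrite ?inE ?notin_setE /=; first by move=> [_ ->].
  by case: (Ws j o) => // -[].
have cT : count (setT `*` [set true]) o = (n1 (Ws ^~ o))%:R.
  rewrite n1E; apply: eq_bigr => j _; rewrite indicE.
  case: (boolP (_ \in _)); rewrite ?inE ?notin_setE /=; first by move=> [_ ->].
  by case: (Ws j o) => // -[].
have lt3 : `|(n0 (Ws ^~ o))%:R - u| < e * u.
  by rewrite -cF ltNge; apply/negP.
have lt4 : `|(n1 (Ws ^~ o))%:R - v| < e * v.
  by rewrite -cT ltNge; apply/negP.
split => gap.
  (* Positivity of both class sizes rules out the conventional value 0 of the estimators. *)
  have [p0 p1 lt] := empirical_ratio_lt u0 v0 a0 b0 m0 e0 e1 gap lt1 lt2 lt3 lt4.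
  by rewrite /phi pX_hatE // pY_hatE // -leNgt ltW.
(* The second claim is the same estimate with the classes exchanged. *)
rewrite ![a + b]addrC in m0 gap lt1 lt2.
have [p0 p1 lt] := empirical_ratio_lt v0 u0 b0 a0 m0 e0 e1 gap lt2 lt1 lt4 lt3.
by rewrite /phi pX_hatE // pY_hatE.
Qed.

End Misclassification.

(** * Summing the pointwise error bounds over a cover *)

Lemma measure_bigsetU_le (R : realType) (d : measure_display)
    (T : measurableType d) (m : {measure set T -> \bar R}) (I : Type) (s : seq I)
    (A : I -> set T) : (forall i, measurable (A i)) ->
  (m (\big[setU/set0]_(i <- s) A i) <= \sum_(i <- s) m (A i))%E.
Proof.
move=> mA; elim: s => [|i s IH]; first by rewrite !big_nil measure0.
rewrite !big_cons; apply: (le_trans (measureU2 _ _ _)) => //.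
  exact: bigsetU_measurable.
exact: leeD2l.
Qed.

Section CoverBound.
Variables (R : realType) (d d' : measure_display).
Variables (X : measurableType d) (T : measurableType d').
Variables (PZ : probability X R) (tau : probability T R).
Variables (rho : X -> X -> R) (mu : set X -> R) (h K : R).
Hypothesis rho_metric : is_metric rho.
Hypothesis mball : forall x e, measurable (rball rho x e).
Hypothesis mu_ge : forall A, measurable A -> fine (PZ A) <= mu A.
Hypothesis mu_le : forall A B, measurable A -> measurable B -> A `<=` B -> mu A <= mu B.
Hypothesis K0 : 0 <= K.

(* A ball of the cover is contained in the [h]-ball around each of its points,
   so its mass cancels the mass in the denominator of the hypothesis and each
   ball contributes at most [K]. *)
Lemma product_measure_cover_le (N : nat) (c : 'I_N -> X) (Y0 S : set X)
    (G : set (X * T)) :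
  measurable Y0 -> measurable S -> measurable G -> PZ Y0 = 1%E ->
  Y0 `<=` \bigcup_(i in [set: 'I_N]) rball rho (c i) (h / 2) ->
  (forall z, S z -> Y0 z -> 0 < mu (rball rho z h) ->
     (tau (xsection G z) <= (K / mu (rball rho z h))%:E)%E) ->
  ((PZ \x tau) (G `&` (S `*` setT)) <= (N%:R * K)%:E)%E.
Proof.
move=> mY0 mS mG PY0 cover bound.
pose U i := rball rho (c i) (h / 2).
pose A i := G `&` ((S `&` Y0 `&` U i) `*` [set: T]).
have mSU i : measurable (S `&` Y0 `&` U i).
  by apply: measurableI; [exact: measurableI|exact: mball].
have mA i : measurable (A i).
  by apply: measurableI => //; exact: measurableX.
have mN : measurable (~` Y0 `*` [set: T]).
  by apply: measurableX => //; exact: measurableC.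
have mGS : measurable (G `&` (S `*` [set: T])).
  by apply: measurableI => //; exact: measurableX.
have mUA : measurable (\big[setU/set0]_(i < N) A i).
  by apply: bigsetU_measurable => i _.
have sub : G `&` (S `*` setT) `<=`
    (\big[setU/set0]_(i < N) A i) `|` (~` Y0 `*` [set: T]).
  move=> [z t] [Gzt [/= Sz _]]; have [Yz|nYz] := pselect (Y0 z); last by right.
  have [i _ Uz] := cover z Yz; left; rewrite -bigcup_seq; exists i => //=.
  by rewrite mem_index_enum.
apply: (@le_trans _ _ ((PZ \x tau) ((\big[setU/set0]_(i < N) A i) `|`
    (~` Y0 `*` [set: T])))%E).
  by apply: le_measure; rewrite ?inE //; exact: measurableU.
apply: (le_trans (measureU2 _ _ _)) => //.
have le0 : ((PZ \x tau) (~` Y0 `*` [set: T]) <= 0)%E.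
  have mCY0 : measurable (~` Y0) by exact: measurableC.
  rewrite (product_measure1E PZ tau mCY0 measurableT).
  change (PZ (~` Y0) * tau setT <= 0)%E.
  by rewrite probability_setC // PY0 subee // mul0e.
apply: (le_trans (leeD2l _ le0)).
rewrite adde0; apply: (le_trans (measure_bigsetU_le _ _ mA)).
have -> : (N%:R * K)%:E = (\sum_(i < N) K%:E)%E.
  by rewrite sumEFin sumr_const card_ord mulr_natl.
apply: lee_sum => i _.
have [_ [_ [sym tri]]] := rho_metric.
have mU : measurable (U i) by exact: mball.
(* A ball without [mu]-mass gives no bound K / mu, but it is null for [PZ] because [mu] dominates
   [PZ]. *)
have [U0|U0] := leP (mu (U i)) 0.
  apply: (@le_trans _ _ ((PZ \x tau) (U i `*` [set: T]))%E).
    apply: le_measure; rewrite ?inE //; first exact: measurableX.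
    by move=> [z t] [_ [[_ ?] _]].
  rewrite (product_measure1E PZ tau mU measurableT).
  rewrite [X in (X <= _)%E](_ : _ = (fine (PZ (U i)))%:E); last first.
    by rewrite -probability_fineE // -[RHS]mule1 -(probability_setT tau).
  rewrite lee_fin.
  by apply: le_trans (mu_ge mU) _; exact: le_trans U0 _.
apply: (@le_trans _ _ (\int[PZ]_z ((K / mu (U i))%:E * (\1_(U i) z)%:E))%E).
  apply: ge0_le_integral => //.
  - exact: measurable_fun_xsection.
  - apply: emeasurable_funM => //.
    by apply/measurable_EFinP; exact: measurable_indic.
  move=> z _ /=; rewrite indicE.
  have [zI|zI] := pselect ((S `&` Y0 `&` U i) z); last first.
    rewrite (_ : xsection (A i) z = set0) ?measure0.
      by rewrite -EFinM lee_fin mulr_ge0 // divr_ge0 // ltW.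
    by apply/seteqP; split => // t; rewrite /xsection /= inE => -[_ [/= ]].
  have [[Sz Yz] Uz] := zI.
  rewrite mem_set //= mule1.
  have UB : U i `<=` rball rho z h.
    move=> y; rewrite /U /rball /= in Uz * => Uy.
    by have := tri z (c i) y; rewrite (sym z (c i)); lra.
  have muUB : mu (U i) <= mu (rball rho z h) by exact: mu_le.
  have mu0 : 0 < mu (rball rho z h) by exact: lt_le_trans muUB.
  apply: (@le_trans _ _ (tau (xsection G z))).
    apply: le_measure; rewrite ?inE //; try exact: measurable_xsection.
    by move=> t; rewrite /xsection /= !inE => -[].
  apply: (le_trans (bound z Sz Yz mu0)).
  by rewrite lee_fin ler_wpM2l // lef_pV2.
rewrite ge0_integralZl //; first last.
- by rewrite lee_fin divr_ge0 // ltW.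
- by apply/measurable_EFinP; exact: measurable_indic.
rewrite integral_indic // setIT.
rewrite [X in (_ * X)%E](_ : _ = PZ (U i)) // probability_fineE // -EFinM lee_fin.
by rewrite mulrAC ler_pdivrMr // ler_wpM2l // mu_ge.
Qed.

End CoverBound.

(** * Integration with respect to product probabilities *)

Lemma product_measure_swap (R : realType) (d d' : measure_display)
    (X : measurableType d) (T : measurableType d') (P : probability X R)
    (tau : probability T R) (F : set (X * T)) : measurable F ->
  (P \x tau)%E F = (\int[tau]_t P (ysection F t))%E.
Proof.
move=> mF; rewrite -[RHS]/((P \x^ tau)%E F).
apply: product_measure_unique mF => A B mA mB; exact: product_measure2E.
Qed.

Lemma full_measure_sum (R : realType) (d : measure_display)
    (T : measurableType d) (PX PY : probability T R) (A : set T) :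
  measurable A -> measure_add PX PY A = 2%:E -> PX A = 1%E /\ PY A = 1%E.
Proof.
move=> mA; rewrite measure_addE.
have := fine_probability_le1 PX mA; have := fine_probability_le1 PY mA.
rewrite [(_ + _)%E](_ : _ = (fine (PX A) + fine (PY A))%:E); last first.
  by rewrite EFinD -!probability_fineE.
move=> Y1 X1 [S2]; rewrite (probability_fineE PX mA) (probability_fineE PY mA).
by split; congr (_%:E); lra.
Qed.

Lemma ge0_integralD_cst (R : realType) (d : measure_display)
    (T : measurableType d) (tau : probability T R) (f g : T -> \bar R) (r : R) :
  measurable_fun setT f -> measurable_fun setT g ->
  (forall t, 0 <= f t)%E -> (forall t, 0 <= g t)%E -> 0 <= r ->
  (\int[tau]_t (f t + g t + r%:E) =
     \int[tau]_t f t + \int[tau]_t g t + r%:E)%E.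
Proof.
move=> mf mg f0 g0 r0.
rewrite (ge0_integralD tau measurableT (f1 := fun t => f t + g t)%E) //.
- rewrite ge0_integralD //; congr (_ + _)%E.
  have := integral_cst tau (@measurableT _ T) r%:E.
  rewrite /cst => ->; transitivity (r%:E * tau setT)%E => //.
  by rewrite probability_setT mule1.
- by move=> t _; rewrite adde_ge0.
- exact: emeasurable_funD.
Qed.

Lemma product_probability_fin (R : realType) (d d' : measure_display)
    (T : measurableType d) (T' : measurableType d') (P : probability T R)
    (Q : probability T' R) (A : set (T * T')) : measurable A ->
  exists r, (P \x Q)%E A = r%:E.
Proof.
move=> mA; pose PQ : probability _ R := (P \x Q)%E.
by exists (fine (PQ A)); exact: probability_fineE.
Qed.

(** * The Hölder condition turns a pointwise margin into a margin on balls *)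

Section LocalGap.
Variables (R : realType) (d : measure_display) (X : measurableType d).
Variables (rho : X -> X -> R) (PX PY : probability X R) (p : X -> R).
Variables (Y0 : set X) (C beta h : R).
Hypothesis rho_ge0 : forall x y, 0 <= rho x y.
Hypothesis mball : forall x e, measurable (rball rho x e).
Hypothesis mp : measurable_fun setT p.
Hypothesis PXp : forall A, measurable A ->
  PX A = (\int[measure_add PX PY]_(x in A) (p x)%:E)%E.
Hypotheses (mY0 : measurable Y0) (PX1 : PX Y0 = 1%E) (PY1 : PY Y0 = 1%E).
Hypothesis holder : forall y z, Y0 y -> Y0 z ->
  `|p y - p z| <= C * rho y z `^ beta.
Hypotheses (C0 : 0 < C) (beta0 : 0 < beta) (h0 : 0 < h).
Hypothesis small : 4 * (C * h `^ beta) <= 1.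

Let k := C * h `^ beta.
Let k0 : 0 <= k. Proof. by rewrite mulr_ge0 ?powR_ge0 // ltW. Qed.

Let full (P : probability X R) A : P Y0 = 1%E -> measurable A ->
  fine (P A) = fine (P (A `&` Y0)).
Proof.
move=> PY01 mA.
by rewrite (fine_probabilityDI P mA mY0) (fine_probability_null mA mY0 PY01) add0r.
Qed.

Let near z y : Y0 z -> (rball rho z h `&` Y0) y -> `|p z - p y| <= k.
Proof.
move=> Yz [zy Yy]; apply: (le_trans (holder Yz Yy)).
rewrite /k ler_pM2l //; apply: ge0_ler_powR; rewrite ?nnegrE ?(ltW beta0) //.
- exact: ltW.
- exact: ltW.
Qed.

(** Within distance [h] in [Y0] the density moves by at most k, hence 2p - 1 by at most 2k, which
    leaves 2k of the margin 4k. Both measures are carried by [Y0], so the ball may be replaced by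
    its trace there. *)
Lemma local_gapX z : Y0 z -> 4 * k < 2 * p z - 1 ->
  2 * k * (fine (PX (rball rho z h)) + fine (PY (rball rho z h))) <=
    fine (PX (rball rho z h)) - fine (PY (rball rho z h)).
Proof.
move=> Yz gap; set B := rball rho z h; have mB : measurable B by exact: mball.
rewrite (full PX1 mB) (full PY1 mB).
apply: (likelihood_excess_ge mp PXp); [by have := k0; lra|exact: measurableI|].
by move=> y /(near Yz); rewrite ler_norml => /andP[]; lra.
Qed.

Lemma local_gapY z : Y0 z -> 2 * p z - 1 < - (4 * k) ->
  2 * k * (fine (PX (rball rho z h)) + fine (PY (rball rho z h))) <=
    fine (PY (rball rho z h)) - fine (PX (rball rho z h)).
Proof.
move=> Yz gap; set B := rball rho z h; have mB : measurable B by exact: mball.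
rewrite (full PX1 mB) (full PY1 mB).
have mBY : measurable (B `&` Y0) by exact: measurableI.
(* The smallness of the bandwidth keeps the threshold in the admissible range. *)
have c1 : -1 <= - (2 * k) by move: small; rewrite -/k; lra.
have le y : (B `&` Y0) y -> 2 * p y - 1 <= - (2 * k).
  by move=> /(near Yz); rewrite ler_norml => /andP[]; lra.
have := likelihood_excess_le mp PXp c1 mBY le; lra.
Qed.

End LocalGap.

(** * A bound on the excess risk for a fixed sample size *)

Section FiniteSample.
Variables (R : realType) (d : measure_display) (X : measurableType d).
Variable rho : X -> X -> R.
Hypothesis rho_metric : is_metric rho.
Hypothesis rho_sep : rho_separable rho.
Hypothesis borel : @measurable d X = <<s rho_open rho >>.
Variables (Y : set X) (n : nat) (w h C beta kappa : R).
Hypotheses (w01 : 0 < w < 1) (h0 : 0 < h) (n_gt0 : (0 < n)%N).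
Hypotheses (C0 : 0 < C) (beta0 : 0 < beta).
Hypothesis small : 4 * (C * h `^ beta) <= 1.
Variables (N : nat) (c : 'I_N -> X).
Hypothesis cover : Y `<=` \bigcup_(i in [set: 'I_N]) rball rho (c i) (h / 2).
Variables PX PY : probability X R.
Hypothesis PXY : in_class rho Y C beta kappa PX PY.

Let rho_ge0 x y : 0 <= rho x y. Proof. by case: rho_metric => H _; exact: H. Qed.
Let mball x e : measurable (rball rho x e).
Proof. exact: measurable_rball. Qed.
(** This relative error satisfies 3e < 2 C h^beta, so the local margin exceeds what the empirical
    comparison requires. *)
Let e := C * h `^ beta / 2.
Let K := 3 / (w * (1 - w)) / (e ^+ 2 * n%:R).
Let mass (A : set X) := fine (PX A) + fine (PY A).
Let F := @decision_set R d X rho n h.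

(** The term 16 C h^beta is the loss 4k of the regret inequality at k = 4 C h^beta; each of the two
    kinds of error contributes N K. *)
Lemma excess_risk_le (d1 : measure_display) (Omega1 : measurableType d1)
    (P1 : probability Omega1 R) (Zs1 : 'I_n -> Omega1 -> X)
    (Ws1 : 'I_n -> Omega1 -> bool) (Z1 : Omega1 -> X)
    (d2 : measure_display) (Omega2 : measurableType d2)
    (P2 : probability Omega2 R) (Zs2 : 'I_n -> Omega2 -> X)
    (Ws2 : 'I_n -> Omega2 -> bool) (Z2 : Omega2 -> X) :
  classification_model P1 w PX PY Zs1 Ws1 Z1 PX ->
  classification_model P2 w PX PY Zs2 Ws2 Z2 PY ->
  (`| P1 [set o | phi rho h (Zs1 ^~ o) (Ws1 ^~ o) (Z1 o)]
    + P2 [set o | ~~ phi rho h (Zs2 ^~ o) (Ws2 ^~ o) (Z2 o)]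
    - 1 + TV PX PY | <=
   (16 * (C * h `^ beta) + 2 * (N%:R * K))%:E)%E.
Proof.
move=> model1 model2.
have [_ _ _ [Y0 [p [[mY0 Y0Y] Y02 mp PXp holder]]]] := PXY.
have [PX1 PY1] := full_measure_sum mY0 Y02.
have hb0 : 0 < h `^ beta by rewrite powR_gt0.
have e0 : 0 < e by rewrite /e divr_gt0 // mulr_gt0.
have e1 : e < 1 by move: small; rewrite /e; lra.
have [w0 w1] := andP w01.
have K0 : 0 <= K.
  have W : 0 < w * (1 - w) by rewrite mulr_gt0 // subr_gt0.
  have e2 : 0 <= e ^+ 2 * n%:R by rewrite mulr_ge0 // sqr_ge0.
  by rewrite /K divr_ge0 // divr_ge0 // ltW.
have mF : measurable F by exact: measurable_decision_set.
have mCF : measurable (~` F) by exact: measurableC.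
(* The training law is taken from the first model; its box values depend only on [w], [PX] and [PY],
   so it also describes the second model. *)
have [tau tauE] := exists_law P1 (measurable_training_tuple model1).
have tau_box (A : 'I_n -> set (X * bool)) : (forall j, measurable (A j)) ->
    tau (tuple_box A) = (\prod_(j < n) labelled_law w PX PY (A j))%E.
  by move=> mA; rewrite tauE (training_box_law model1).
have law1 := joint_law_product model1 tau_box mF.
have law2 := joint_law_product model2 tau_box mCF.
pose k := 4 * (C * h `^ beta).
have k01 : 0 <= k <= 1 by rewrite small andbT /k !mulr_ge0 // ltW.
pose Sp : set X := [set z | k < 2 * p z - 1].
pose Sm : set X := [set z | 2 * p z - 1 < - k].
have m2p := measurable_funM (measurable_cst (2 : R)) mp.
have mp2 : measurable_fun setT (fun z => 2 * p z - 1).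
  exact: (measurable_funB m2p (measurable_cst (1 : R))).
have mSp : measurable Sp.
  have -> : Sp = (fun z => 2 * p z - 1) @^-1` `]k, +oo[.
    by apply/seteqP; split => z; rewrite /Sp /= in_itv /= andbT.
  by rewrite -[X in measurable X]setTI; exact: mp2.
have mSm : measurable Sm.
  have -> : Sm = (fun z => 2 * p z - 1) @^-1` `]-oo, -k[.
    by apply/seteqP; split => z; rewrite /Sm /= in_itv.
  by rewrite -[X in measurable X]setTI; exact: mp2.
have mass_le A B : measurable A -> measurable B -> A `<=` B -> mass A <= mass B.
  by move=> mA mB AB; apply: lerD; exact: fine_probability_le.
have boundX z : Sp z -> Y0 z -> 0 < mass (rball rho z h) ->
    (tau (xsection F z) <= (K / mass (rball rho z h))%:E)%E.
  move=> Sz Yz m0.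
  have gap := local_gapX rho_ge0 mball mp PXp mY0 PX1 PY1 holder
    C0 beta0 h0 Yz Sz.
  have [D [mD PD] nD] :=
    good_event rho_metric borel w01 h0 n_gt0 model1 m0 e0 e1.
  rewrite tauE; apply: (le_trans _ PD); apply: le_measure; rewrite ?inE //.
    rewrite -[X in measurable X]setTI; apply: (measurable_training_tuple model1) => //.
    exact: measurable_xsection.
  move=> o; rewrite /xsection /= inE /F decision_setE => H.
  apply: contrapT => /nD[+ _] => /(_ _)/negP; apply => //.
  apply: lt_le_trans gap; rewrite ltr_pM2r // /e.
  have : 0 < C * h `^ beta by rewrite mulr_gt0.
  lra.
have boundY z : Sm z -> Y0 z -> 0 < mass (rball rho z h) ->
    (tau (xsection (~` F) z) <= (K / mass (rball rho z h))%:E)%E.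
  move=> Sz Yz m0.
  have gap := local_gapY rho_ge0 mball mp PXp mY0 PX1 PY1 holder
    C0 beta0 h0 small Yz Sz.
  have [D [mD PD] nD] :=
    good_event rho_metric borel w01 h0 n_gt0 model1 m0 e0 e1.
  rewrite tauE; apply: (le_trans _ PD); apply: le_measure; rewrite ?inE //.
    rewrite -[X in measurable X]setTI; apply: (measurable_training_tuple model1) => //.
    exact: measurable_xsection.
  move=> o; rewrite /xsection /= inE /F /= decision_setE => H.
  apply: contrapT => /nD[_ gapD]; apply: H; apply: gapD.
  apply: lt_le_trans gap; rewrite ltr_pM2r // /e.
  have : 0 < C * h `^ beta by rewrite mulr_gt0.
  lra.
have cover0 := subset_trans Y0Y cover.
have massX A : measurable A -> fine (PX A) <= mass A.
  by move=> _; rewrite lerDl fine_probability_ge0.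
have massY A : measurable A -> fine (PY A) <= mass A.
  by move=> _; rewrite lerDr fine_probability_ge0.
have riskX := product_measure_cover_le rho_metric mball massX mass_le K0
  mY0 mSp mF PX1 cover0 boundX.
have riskY := product_measure_cover_le rho_metric mball massY mass_le K0
  mY0 mSm mCF PY1 cover0 boundY.
pose GX := F `&` (Sp `*` [set: n.-tuple (X * bool)]).
pose GY := ~` F `&` (Sm `*` [set: n.-tuple (X * bool)]).
have mGX : measurable GX by apply: measurableI => //; exact: measurableX.
have mGY : measurable GY by apply: measurableI => //; exact: measurableX.
(* Finiteness of the total variation comes from the regret inequality for the empty region. *)
have [tv tvE] : exists tv : R, TV PX PY = tv%:E.
  have := TV_le_regret mp PXp k01 (@measurable0 _ X).
  have := regret_ge0 PX PY (@measurable0 _ X).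
  rewrite !measure0 /= subrr; case: (TV PX PY) => [r _ _|//|//]; by exists r.
have tv0 : 0 <= tv.
  have := regret_ge0 PX PY (@measurable0 _ X).
  by rewrite !measure0 /= subrr tvE lee_fin.
(* Tonelli writes the error probabilities as integrals over training samples, so that the regret
   inequalities can be applied to each section. *)
have eX : (PX \x tau)%E F = (\int[tau]_t PX (ysection F t))%E.
  exact: product_measure_swap.
have eY : (PY \x tau)%E (~` F) = (\int[tau]_t PY (ysection (~` F) t))%E.
  exact: product_measure_swap.
have eGX : (PX \x tau)%E GX = (\int[tau]_t PX (ysection GX t))%E.
  exact: product_measure_swap.
have eGY : (PY \x tau)%E GY = (\int[tau]_t PY (ysection GY t))%E.
  exact: product_measure_swap.
have mfX := measurable_fun_ysection PX mF.
have mfY := measurable_fun_ysection PY mCF.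
have mgX := measurable_fun_ysection PX mGX.
have mgY := measurable_fun_ysection PY mGY.
have ysecC t : ysection (~` F) t = ~` ysection F t.
  by apply/seteqP; split => z; rewrite /ysection /= !inE.
have sum1 : (\int[tau]_t (PX (ysection F t) + PY (ysection (~` F) t) + tv%:E) =
    (PX \x tau) F + (PY \x tau) (~` F) + tv%:E)%E.
  by rewrite eX eY; apply: ge0_integralD_cst => //.
have sum2 : (\int[tau]_t (PX (ysection GX t) + PY (ysection GY t) +
      (1 + 4 * k)%:E) =
    (PX \x tau) GX + (PY \x tau) GY + (1 + 4 * k)%:E)%E.
  rewrite eGX eGY; apply: ge0_integralD_cst => //.
  by move: k01; lra.
have mysX t : measurable (ysection F t) by exact: measurable_ysection.
(* Integrating the nonnegativity of the regret removes the absolute value in the conclusion; [upper]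
   integrates the matching upper bound. *)
have lower : (1 <= (PX \x tau) F + (PY \x tau) (~` F) + tv%:E)%E.
  rewrite -sum1 -[leLHS](_ : \int[tau]_t 1%:E = _)%E; last first.
    have := integral_cst tau (@measurableT _ (n.-tuple (X * bool)%type)) 1%:E.
    rewrite /cst => ->; transitivity (1%:E * tau setT)%E => //.
    by rewrite probability_setT mule1.
  apply: ge0_le_integral => //.
  - by apply: emeasurable_funD => //; exact: emeasurable_funD.
  move=> t _; have := regret_ge0 PX PY (mysX t).
  rewrite tvE ysecC (probability_fineE PX (mysX t)).
  rewrite (probability_fineE PY (measurableC (mysX t))) fine_probabilityC //.
  by rewrite -!EFinD !lee_fin; lra.
have upper : ((PX \x tau) F + (PY \x tau) (~` F) + tv%:E <=
    (PX \x tau) GX + (PY \x tau) GY + (1 + 4 * k)%:E)%E.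
  rewrite -sum1 -sum2; apply: ge0_le_integral => //.
  - by move=> t _; rewrite !adde_ge0.
  - by apply: emeasurable_funD => //; exact: emeasurable_funD.
  - by apply: emeasurable_funD => //; exact: emeasurable_funD.
  move=> t _; have := TV_le_regret mp PXp k01 (mysX t).
  have -> : [set z | (k < 2 * p z - 1)%R] `&` ysection F t = ysection GX t.
    by apply/seteqP; split => z; rewrite /ysection /= !inE /GX /= => -[] //; tauto.
  have -> : [set z | (2 * p z - 1 < - k)%R] `\` ysection F t = ysection GY t.
    by apply/seteqP; split => z; rewrite /ysection /= !inE /GY /= => -[] //; tauto.
  have mX : measurable (ysection GX t) by exact: measurable_ysection.
  have mY : measurable (ysection GY t) by exact: measurable_ysection.
  rewrite tvE ysecC (probability_fineE PX (mysX t)).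
  rewrite (probability_fineE PY (measurableC (mysX t))) fine_probabilityC //.
  rewrite (probability_fineE PX mX) (probability_fineE PY mY).
  by rewrite -!EFinD !lee_fin /=; lra.
have -> : P1 [set o | phi rho h (Zs1 ^~ o) (Ws1 ^~ o) (Z1 o)] = (PX \x tau)%E F.
  by rewrite -law1; congr (P1 _); apply/seteqP; split => o /=; rewrite /F decision_setE.
have -> : P2 [set o | ~~ phi rho h (Zs2 ^~ o) (Ws2 ^~ o) (Z2 o)] =
    (PY \x tau)%E (~` F).
  rewrite -law2; congr (P2 _).
  by apply/seteqP; split => o /=; rewrite /F /= decision_setE => /negP.
have [r1 r1E] : exists r, (PX \x tau)%E F = r%:E.
  exact: product_probability_fin.
have [r2 r2E] : exists r, (PY \x tau)%E (~` F) = r%:E.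
  exact: product_probability_fin.
move: lower upper riskX riskY; rewrite -/GX -/GY r1E r2E tvE.
have [g1 ->] : exists r, (PX \x tau)%E GX = r%:E.
  exact: product_probability_fin.
have [g2 ->] : exists r, (PY \x tau)%E GY = r%:E.
  exact: product_probability_fin.
rewrite -!EFinD !lee_fin => lower upper riskX riskY.
change (`|r1 + r2 - 1 + tv| <= 16 * (C * h `^ beta) + 2 * (N%:R * K)).
by rewrite ger0_norm; move: upper; rewrite /k; lra.
Qed.

End FiniteSample.

(** * Covering numbers and asymptotics of the bandwidth *)

Lemma covering_number_attained (R : realType) (T : Type) (rho : T -> T -> R)
    (s : R) (Y : set T) (N : nat) : covering_number rho s Y = (N%:R)%:E ->
  exists k : nat, (k <= N)%N /\ exists c : 'I_k -> T,
    Y `<=` \bigcup_(i in [set: 'I_k]) rball rho (c i) s.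
Proof.
rewrite /covering_number => inf_eq.
(* An admissible size below N + 1 exists by the definition of the infimum, and being an integer it
   is at most N. *)
have : (covering_number rho s Y < (N.+1%:R)%:E)%E.
  by rewrite /covering_number inf_eq lte_fin ltr_nat.
move=> /ereal_inf_lt[_ [k [c cover] <-]]; rewrite lte_fin ltr_nat ltnS => kN.
by exists k; split => //; exists c.
Qed.

(** The choice of [s] gives q d L s = L/2, so ln x < x at x = d L s yields the exponential; the
    constant s^(-q) compensates for the scaling. With L = log n this compares powers of log n with
    sqrt n. *)
Lemma powR_le_expR_half (R : realType) (d q : R) : 0 < d -> 0 < q ->
  exists2 M : R, 0 < M & forall L, 0 < L -> (d * L) `^ q <= M * expR (L / 2).
Proof.
move=> d0 q0; pose s := (2 * q * d)^-1.
have s0 : 0 < s by rewrite invr_gt0 !mulr_gt0.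
exists (expR (- (q * ln s))); first exact: expR_gt0.
move=> L L0; have dL0 : 0 < d * L by rewrite mulr_gt0.
rewrite /powR gt_eqF // -expRD ler_expR.
have : ln (d * L * s) < d * L * s by apply: ln_sublinear; rewrite mulr_gt0.
rewrite lnM ?posrE // => lt_s.
have -> : L / 2 = q * (d * L * s).
  by rewrite /s; field; rewrite !gt_eqF.
rewrite -mulrN -mulrDr ler_pM2l //; lra.
Qed.

Section Bandwidth.
Variables (R : realType) (d gamma : R) (n : nat).
Hypotheses (d0 : 0 < d) (gamma0 : 0 < gamma) (L0 : 0 < ln (n%:R : R)).
Let L : R := ln n%:R.
Let h := bandwidth d gamma n.

Let dL0 : 0 < d * L. Proof. by rewrite mulr_gt0. Qed.

Lemma bandwidth_gt0 : 0 < h.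
Proof. by rewrite powR_gt0. Qed.

Lemma bandwidth_powR x : h `^ x = (d * L) `^ (- (x / gamma)).
Proof. by rewrite /h /bandwidth -powRrM mulNr [_^-1 * x]mulrC. Qed.

(** At radius h/2 the metric entropy is therefore at most linear in log n, and the cover has at most
    a power of n balls. *)
Lemma half_bandwidth_powRN : (h / 2) `^ (- gamma) = 2 `^ gamma * (d * L).
Proof.
rewrite powRM ?invr_ge0 // ?ltW ?bandwidth_gt0 // bandwidth_powR.
rewrite mulNr divff ?gt_eqF // opprK powRr1 ?ltW // mulrC; congr (_ * _).
have -> : 2^-1 = 2 `^ (-1) :> R by rewrite powR_inv1.
by rewrite -powRrM mulN1r opprK.
Qed.

Lemma bandwidth_lt s : 0 < s -> s `^ (- gamma) < d * L -> h < s.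
Proof.
move=> s0 lt; rewrite -[h]powRr1 ?ltW ?bandwidth_gt0 // bandwidth_powR mul1r.
rewrite powRN invf_plt ?posrE ?powR_gt0 //.
rewrite -(powR_inv1 (ltW s0)).
have -> : -1 = - gamma * gamma^-1 by rewrite mulNr divff ?gt_eqF.
by rewrite powRrM gt0_ltr_powR ?invr_gt0 // ?nnegrE ?powR_ge0 // ltW.
Qed.

End Bandwidth.

(** * Choice of the constants and the logarithmic rate *)

Theorem theorem3 (R : realType) (dX : measure_display) (X : measurableType dX)
  (rho : X -> X -> R)
  (hpolish : polish_metric rho)
  (hborel : @measurable dX X = <<s rho_open rho >>)
  (hne : [set: X] !=set0)
  (Y : set X) (mY : measurable Y)
  (s0 c0 c1 gamma : R) (hs0 : 0 < s0) (hc0 : 0 < c0) (hc01 : c0 < c1)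
  (hgamma : 0 < gamma)
  (hcov : forall s : R, 0 < s -> s < s0 ->
     exists N : nat, covering_number rho s Y = (N%:R)%:E /\
       c0 * s `^ (- gamma) <= ln N%:R <= c1 * s `^ (- gamma))
  (C beta kappa : R) (hC : 0 < C) (hbeta : 0 < beta <= 1) (hkappa : 0 < kappa)
  (w : R) (hw : 0 < w < 1)
  (eta d : R) (heta : 0 < eta < 1 / 2)
  (hd : 0 < d < eta * c1^-1 * 4 `^ (- gamma)) :
  exists (M : R) (N : nat), forall n : nat, (N <= n)%N ->
  forall PX PY : probability X R, in_class rho Y C beta kappa PX PY ->
  forall (d1 : measure_display) (Omega1 : measurableType d1)
         (P1 : probability Omega1 R)
         (Zs1 : 'I_n -> Omega1 -> X) (Ws1 : 'I_n -> Omega1 -> bool)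
         (Z1 : Omega1 -> X),
    classification_model P1 w PX PY Zs1 Ws1 Z1 PX ->
  forall (d2 : measure_display) (Omega2 : measurableType d2)
         (P2 : probability Omega2 R)
         (Zs2 : 'I_n -> Omega2 -> X) (Ws2 : 'I_n -> Omega2 -> bool)
         (Z2 : Omega2 -> X),
    classification_model P2 w PX PY Zs2 Ws2 Z2 PY ->
  (`| P1 [set o | phi rho (bandwidth d gamma n) (Zs1 ^~ o) (Ws1 ^~ o) (Z1 o)]
    + P2 [set o | ~~ phi rho (bandwidth d gamma n) (Zs2 ^~ o) (Ws2 ^~ o) (Z2 o)]
    - 1 + TV PX PY |
   <= (M * (ln n%:R) `^ (- (beta / gamma)))%:E)%E.
Proof.
have [w0 w1] := andP hw; have [beta0 _] := andP hbeta.
have [eta0 eta12] := andP heta; have [d0 dlt] := andP hd.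
have [rho_metric rho_sep _] := hpolish.
have c1_gt0 : 0 < c1 by exact: lt_trans hc01.
pose a := beta / gamma.
have a0 : 0 < a by rewrite divr_gt0.
(* The variance term carries h^(-2 beta); division by the target h^beta gives h^(-3 beta) = (d log
   n)^(3a). *)
have [M3 M30 decay] := powR_le_expR_half d0 (mulr_gt0 (ltr0n R 3) a0).
pose Q := 3 / (w * (1 - w)).
have Q0 : 0 < Q by rewrite divr_gt0 // mulr_gt0 // subr_gt0.
(* Once log n exceeds [L0], the first summand gives h/2 < s0 and the second gives 4 C h^beta <=
   1. *)
pose L0 := ((2 * s0) `^ (- gamma) + (4 * C) `^ a^-1) / d.
(* The two summands belong to the margin loss and to the variance term; d^(-a) converts h^beta into
   (log n)^(-a). *)
exists ((16 * C + 8 * Q / C ^+ 2 * M3) * d `^ (- a)), (Num.truncn (expR L0)).+1.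
move=> n len PX PY PXY d1 Omega1 P1 Zs1 Ws1 Z1 model1
  d2 Omega2 P2 Zs2 Ws2 Z2 model2.
have n_gt0 : (0 < n)%N by exact: leq_trans len.
have N0 : 0 < n%:R :> R by rewrite ltr0n.
have expL0 : expR L0 < n%:R.
  by apply: lt_le_trans (truncnS_gt _) _; rewrite ler_nat.
set L := ln (n%:R : R).
have nE : n%:R = expR L :> R by rewrite /L lnK.
have L0L : L0 < L by rewrite -ltr_expR -nE.
have A1 : 0 < (2 * s0) `^ (- gamma) by rewrite powR_gt0 // mulr_gt0.
have A2 : 0 < (4 * C) `^ a^-1 by rewrite powR_gt0 // mulr_gt0.
have dL : (2 * s0) `^ (- gamma) + (4 * C) `^ a^-1 < d * L.
  by rewrite [d * L]mulrC -ltr_pdivrMr.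
have L_gt0 : 0 < L by apply: lt_trans L0L; rewrite divr_gt0 // addr_gt0.
pose h := bandwidth d gamma n.
have h0 : 0 < h by exact: bandwidth_gt0.
have hs : h < 2 * s0.
  by apply: bandwidth_lt => //; [rewrite mulr_gt0|rewrite -/L; lra].
have hb : h `^ beta = (d * L) `^ (- a) by exact: bandwidth_powR.
have dL0 : 0 < d * L by rewrite mulr_gt0.
have small : 4 * (C * h `^ beta) <= 1.
  rewrite hb powRN mulrA ler_pdivrMr ?powR_gt0 // mul1r.
  have C40 : 0 <= 4 * C by rewrite mulr_ge0 // ltW.
  have -> : 4 * C = ((4 * C) `^ a^-1) `^ a.
    by rewrite -powRrM mulVf ?powRr1 // lt0r_neq0.
  apply: ge0_ler_powR; rewrite ?nnegrE ?powR_ge0 // ltW //.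
  by apply: le_lt_trans dL; rewrite lerDr ltW.
have [N [covN /andP[lnN_ge lnN_le]]] :
    exists N : nat, covering_number rho (h / 2) Y = (N%:R)%:E /\
      c0 * (h / 2) `^ (- gamma) <= ln N%:R <= c1 * (h / 2) `^ (- gamma).
  by apply: hcov; [rewrite divr_gt0|rewrite ltr_pdivrMr // mulrC].
have [k [kN [c cover]]] := covering_number_attained covN.
have N_gt0 : 0 < N%:R :> R.
  (* Since [ln] takes the value 0 at 0, [N = 0] contradicts the positive lower entropy bound. *)
  rewrite ltr0n lt0n; apply/eqP => N00; move: lnN_ge; rewrite N00 ln0 //.
  by rewrite leNgt mulr_gt0 // powR_gt0 // divr_gt0.
(* The restriction on [d] gives c1 d 2^gamma < eta 2^(-gamma) <= 1/2, so the cover has at most sqrt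
   n balls. *)
have Nle : N%:R <= expR (L / 2).
  rewrite -[leLHS]lnK // ler_expR; apply: (le_trans lnN_le).
  rewrite half_bandwidth_powRN // -/L.
  have p2 : 0 < 2 `^ gamma :> R by rewrite powR_gt0.
  have p4 : 4 `^ (- gamma) * 2 `^ gamma = (2 `^ gamma)^-1 :> R.
    rewrite powRN (_ : 4 = 2 * 2) ?powRM //; last by rewrite -natrM.
    by rewrite invfM -mulrA mulVf ?mulr1 // gt_eqF.
  have p21 : 1 <= 2 `^ gamma :> R.
    by rewrite -[leLHS](powRr0 2) ler_powR ?ler1n // ltW.
  have cd : c1 * d * 2 `^ gamma <= 1 / 2.
    have : d * c1 < eta * 4 `^ (- gamma).
      by rewrite -ltr_pdivlMr // mulrAC.
    move=> lt1; apply: (@le_trans _ _ (eta * (2 `^ gamma)^-1)).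
      by rewrite -p4 mulrA ler_pM2r // [c1 * d]mulrC ltW.
    by rewrite ler_pdivrMr //; nra.
  have -> : c1 * (2 `^ gamma * (d * L)) = (c1 * d * 2 `^ gamma) * L by ring.
  by rewrite [L / 2]mulrC -div1r ler_pM2r.
have risk := excess_risk_le rho_metric rho_sep hborel hw h0 n_gt0 hC beta0 small
  cover PXY model1 model2.
apply: (le_trans risk); rewrite lee_fin -/L.
have Lb : d `^ (- a) * L `^ (- a) = h `^ beta.
  by rewrite hb powRM // ltW.
rewrite -[leRHS]mulrA -/a Lb [leRHS]mulrDl; apply: lerD; first by rewrite mulrA.
set x := h `^ beta.
have x0 : 0 < x by rewrite powR_gt0.
have x3 : 1 <= M3 * expR (L / 2) * x ^+ 3.
  have -> : x ^+ 3 = ((d * L) `^ (3 * a))^-1.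
    by rewrite /x hb -powR_mulrn ?powR_ge0 // -powRrM -powRN; congr (_ `^ _); ring.
  by rewrite ler_pdivlMr ?powR_gt0 // mul1r decay.
have kle : k%:R <= expR (L / 2) by apply: le_trans Nle; rewrite ler_nat.
set E := expR (L / 2) in kle x3 *.
have E0 : 0 < E by exact: expR_gt0.
have nEE : n%:R = E * E by rewrite nE /E -expRD; congr expR; field.
rewrite -/Q nEE.
have -> : 2 * (k%:R * (Q / ((C * x / 2) ^+ 2 * (E * E)))) =
    8 * Q / C ^+ 2 * (k%:R / (x ^+ 2 * (E * E))).
  by field; rewrite !gt_eqF.
rewrite -[leRHS]mulrA ler_pM2l; last by rewrite divr_gt0 ?exprn_gt0 // mulr_gt0.
rewrite ler_pdivrMr; last by rewrite mulr_gt0 ?exprn_gt0 // mulr_gt0.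
apply: (le_trans kle).
(* One factor E = sqrt n pays for h^(-3 beta) through [x3]; the other bounds the number of balls. *)
have -> : M3 * x * (x ^+ 2 * (E * E)) = M3 * E * x ^+ 3 * E by ring.
by rewrite ler_peMl // ltW.
Qed.
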